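(* For any $a>0$, $\sigma>0$ and any integers $n,p,s\ge 1$ with $s<p$, and for every $s'\in(0,s]$, $$\inf_{\tilde\eta}\ \sup_{\beta\in\Omega^p_{s,a}}\mathbf{E}_\beta|\tilde\eta-\eta_\beta|\ \ge\ \frac{s'}{s}\Big(\psi_+(n,p,s,a,\sigma)-4s\,e^{-\frac{(s-s')^2}{2s}}\Big),$$ where the infimum is over all selectors $\tilde\eta$.
   Context: Model: $Y=X\beta+\sigma\xi\in\mathbb{R}^n$, where $X\in\mathbb{R}^{n\times p}$ has i.i.d. $\mathcal N(0,1)$ entries, $\xi\sim\mathcal N(0,\mathbb I_n)$ is independent of $X$, $\beta\in\mathbb{R}^p$ unknown, $\sigma>0$. $\mathbf P_\beta,\mathbf E_\beta$ denote the joint law of $(X,Y)$ and its expectation. For $a>0$ and integer $s\le p$, $\Omega^p_{s,a}=\{\beta\in\mathbb{R}^p: |\beta|_0\le s,\ |\beta_i|\ge a\ \forall i \text{ with }\beta_i\neq0\}$, where $|\beta|_0$ is the number of nonzero entries. $\eta_\beta=(\mathbf 1\{\beta_1\neq0\},\dots,\mathbf 1\{\beta_p\neq0\})$. A selector is a measurable function $\tilde\eta=\tilde\eta(X,Y)$ with values in $\{0,1\}^p$; $|\tilde\eta-\eta_\beta|$ is the Hamming distance. For $\sigma>0$ define the threshold $t_\sigma(u)=\frac{a\|u\|}{2}+\frac{\sigma^2\log(\frac ps-1)}{a\|u\|}$ for $u\in\mathbb{R}^n$, and $$\psi_+(n,p,s,a,\sigma)=(p-s)\mathbf P(\sigma\varepsilon>t_\sigma(\zeta))+s\,\mathbf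 P(\sigma\varepsilon\ge a\|\zeta\|-t_\sigma(\zeta)),$$ where $\varepsilon\sim\mathcal N(0,1)$ and $\zeta\sim\mathcal N(0,\mathbb I_n)$ are independent. *)

(* Defs.v *)
From HB Require Import structures.
From mathcomp Require Import all_boot all_order all_algebra.
From mathcomp Require Import all_classical all_reals all_analysis.
From mathcomp Require Import normal_distribution.

Set Implicit Arguments.
Unset Strict Implicit.
Unset Printing Implicit Defensive.

Import Order.TTheory GRing.Theory Num.Theory.
Local Open Scope classical_set_scope.
Local Open Scope ring_scope.

(* Expectation of f(Z) for Z a standard Gaussian vector of R^m (i.i.d.
   N(0,1) coordinates), written as the iterated integral against the
   one-dimensional standard normal law [normal_prob 0 1]. *)
Fixpoint gauss_exp {R : realType} (m : nat) :
    (m.-tuple R -> \bar R) -> \bar R :=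
  match m as m0 return (m0.-tuple R -> \bar R) -> \bar R with
  | 0 => fun f => f [tuple]
  | m'.+1 => fun f =>
      (\int[normal_prob (0:R) 1]_x gauss_exp (fun t => f (cons_tuple x t)))%E
  end.

Definition norm2 {R : realType} (n : nat) (u : 'cV[R]_n) : R :=
  Num.sqrt (\sum_(i < n) u i ord0 ^+ 2).

Definition Omega {R : realType} (p s : nat) (a : R) : set 'cV[R]_p :=
  [set b : 'cV[R]_p | (#|[set j : 'I_p | b j ord0 != 0%R]| <= s)%N /\
           forall j : 'I_p, b j ord0 != 0 -> a <= `|b j ord0|].

Definition eta_of {R : realType} (p : nat) (b : 'cV[R]_p) : 'I_p -> bool :=
  fun j => b j ord0 != 0.

Definition hamming (p : nat) (u v : 'I_p -> bool) : nat :=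
  (\sum_(j < p) (u j != v j))%N.

(* The sample (X, xi) is encoded as a (n*p + n)-tuple of reals:
   the first n*p coordinates are the entries of X (via mxvec_index),
   the last n are xi. *)
Definition decX {R : realType} (n p : nat) (t : (n * p + n).-tuple R)
  : 'M[R]_(n, p) := \matrix_(i, j) tnth t (lshift n (mxvec_index i j)).

Definition decXi {R : realType} (n p : nat) (t : (n * p + n).-tuple R)
  : 'cV[R]_n := \col_i tnth t (rshift (n * p) i).

(* A selector: a function of (X, Y) with values in {0,1}^p, which is
   (Borel) measurable: each coordinate is measurable, measurability being
   tested through the (bijective, bi-continuous) coordinate encoding of
   (X, Y) as a (n*p+n)-tuple. *)
Definition selector {R : realType} (n p : nat)
    (eta : 'M[R]_(n, p) -> 'cV[R]_n -> 'I_p -> bool) : Prop :=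
  forall j : 'I_p,
    measurable [set t : (n * p + n).-tuple R | eta (decX t) (decXi t) j].

Definition risk {R : realType} (n p : nat) (sigma : R)
    (eta : 'M[R]_(n, p) -> 'cV[R]_n -> 'I_p -> bool) (b : 'cV[R]_p) : \bar R :=
  gauss_exp (fun t : (n * p + n).-tuple R =>
    let X := decX t in
    let Y := X *m b + sigma *: decXi t in
    ((hamming (eta X Y) (eta_of b))%:R)%:E).

Definition tsig {R : realType} (n p s : nat) (a sigma : R) (u : 'cV[R]_n) : R :=
  a * norm2 u / 2 + sigma ^+ 2 * ln (p%:R / s%:R - 1) / (a * norm2 u).

Definition epsof {R : realType} (n : nat) (t : n.+1.-tuple R) : R :=
  tnth t ord0.
Definition zetaof {R : realType} (n : nat) (t : n.+1.-tuple R) : 'cV[R]_n :=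
  \col_i tnth t (lift ord0 i).

Definition psi_plus {R : realType} (n p s : nat) (a sigma : R) : \bar R :=
  ((p - s)%:R%:E *
     gauss_exp (fun t : n.+1.-tuple R =>
       (\1_[set t | sigma * epsof t > tsig p s a sigma (zetaof t)] t)%:E)
   + s%:R%:E *
     gauss_exp (fun t : n.+1.-tuple R =>
       (\1_[set t | sigma * epsof t >=
                     a * norm2 (zetaof t) - tsig p s a sigma (zetaof t)] t)%:E))%E.

Arguments Omega {R} p s a _.

(* Main.v *)
(** The minimax risk dominates the Bayes risk for the prior under which
    [beta = a * eta] with [eta] i.i.d. Bernoulli([s' / p]), restricted to
    [|eta| <= s].  A selector may be truncated to 0 wherever it picks more than
    [2 s] coordinates: this does not increase the loss when [|eta| <= s], and
    bounds the loss by [2 s + |eta|] in general, so that by a Chernoff bound the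
    event [|eta| > s] costs at most [3 s' exp (- (s - s')^2 / (2 s))].  The Bayes
    risk splits into coordinates; resampling coordinate [j] turns each term into
    a simple-vs-simple test between two shifts of the noise by the [j]-th column
    of [X].  Neyman-Pearson, through the Cameron-Martin formula, identifies the
    optimal error given [X] as a function of the norm of that column, and its
    expectation is [psi_plus].  Finally
    [1 - s' / p >= (s' / s) (p - s) / p] compares the weights of the two errors. *)
Require Import Defs.
From HB Require Import structures.
From mathcomp Require Import all_boot all_order all_algebra.
From mathcomp Require Import all_classical all_reals all_analysis.
From mathcomp Require Import measurable_realfun normal_distribution.
From mathcomp Require Import ring lra zify.

Import Order.TTheory GRing.Theory Num.Theory.
Local Open Scope classical_set_scope.
Local Open Scope ring_scope.

Set Implicit Arguments.
Unset Strict Implicit.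
Unset Printing Implicit Defensive.

(** * One-dimensional Gaussian expectation *)

Section one_dimensional.
Context {R : realType}.
Local Notation mu := (@lebesgue_measure R).
Local Notation phi := (normal_pdf (0 : R) 1).

Definition gexp1 (f : R -> \bar R) : \bar R :=
  (\int[normal_prob (0:R) 1]_x f x)%E.

Lemma gexp1_ge0 (f : R -> \bar R) : (forall x, 0 <= f x)%E -> (0 <= gexp1 f)%E.
Proof. by move=> f0; exact: integral_ge0. Qed.

Lemma gexp1_cst (c : \bar R) : gexp1 (fun=> c) = c.
Proof.
have N1 := @probability_setT _ _ _ (normal_prob (0:R) 1).
by rewrite /gexp1 integral_cst// -[RHS]mule1 -N1.
Qed.

Lemma gexp1D (f g : R -> \bar R) :
  measurable_fun setT f -> measurable_fun setT g ->
  (forall x, 0 <= f x)%E -> (forall x, 0 <= g x)%E ->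
  gexp1 (fun x => f x + g x)%E = (gexp1 f + gexp1 g)%E.
Proof. by move=> mf mg f0 g0; exact: ge0_integralD. Qed.

Lemma gexp1Zl (k : R) (f : R -> \bar R) :
  measurable_fun setT f -> (forall x, 0 <= f x)%E -> (0 <= k) ->
  gexp1 (fun x => k%:E * f x)%E = (k%:E * gexp1 f)%E.
Proof. by move=> mf f0 k0; exact: ge0_integralZl_EFin. Qed.

Lemma gexp1_le (f g : R -> \bar R) :
  measurable_fun setT f -> measurable_fun setT g ->
  (forall x, 0 <= f x)%E -> (forall x, f x <= g x)%E ->
  (gexp1 f <= gexp1 g)%E.
Proof. by move=> mf mg f0 fg; apply: ge0_le_integral. Qed.

Lemma measurable_gexp1 d (T : measurableType d) (f : T * R -> \bar R) :
  measurable_fun setT f -> (forall x, 0 <= f x)%E ->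
  measurable_fun setT (fun t => gexp1 (fun x => f (t, x))).
Proof.
move=> mf f0.
exact: (@measurable_fun_fubini_tonelli_F _ _ T (measurableTypeR R) R
  (normal_prob (0:R) 1) f).
Qed.

Lemma gexp1_swap (f : R * R -> \bar R) :
  measurable_fun setT f -> (forall x, 0 <= f x)%E ->
  gexp1 (fun x => gexp1 (fun y => f (x, y))) =
  gexp1 (fun y => gexp1 (fun x => f (x, y))).
Proof.
move=> mf f0.
exact: (@fubini_tonelli _ _ (measurableTypeR R) (measurableTypeR R) R
  (normal_prob (0:R) 1) (normal_prob (0:R) 1) f).
Qed.

(** The Radon-Nikodym derivative of the normal law and the explicit density have the same integral
    over every measurable set, so they agree almost everywhere. *)
Lemma gexp1_pdf (f : R -> \bar R) :
  measurable_fun setT f -> (forall x, 0 <= f x)%E ->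
  gexp1 f = (\int[mu]_x (f x * (phi x)%:E))%E.
Proof.
move=> mf f0; rewrite /gexp1.
have dom := normal_prob_dominates (0:R) 1.
rewrite -(Radon_Nikodym_SigmaFinite.change_of_variables dom)//.
have mphi : measurable_fun setT (EFin \o phi).
  by apply/measurable_EFinP; exact: measurable_normal_pdf.
have intf := Radon_Nikodym_SigmaFinite.f_integrable dom.
apply: ae_eq_integral => //.
- by apply: emeasurable_funM => //; exact: measurable_int intf.
- exact: emeasurable_funM.
- apply: ae_eqe_mul2l; apply: integral_ae_eq => // E _ mE.
  by rewrite -Radon_Nikodym_SigmaFinite.f_integral.
Qed.

(** The image of Lebesgue measure under a translation gives each half-open interval its length, and
    these values determine the measure. *)
Lemma lebesgue_integral_shift (f : R -> \bar R) (c : R) :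
  measurable_fun setT f -> (forall x, 0 <= f x)%E ->
  (\int[mu]_x f (x + c)%R = \int[mu]_x f x)%E.
Proof.
move=> mf f0.
have mshift : measurable_fun setT (shift c : measurableTypeR R -> measurableTypeR R).
  exact: measurable_funD.
transitivity (\int[pushforward mu
  (shift c : measurableTypeR R -> measurableTypeR R)]_x f x)%E.
  by rewrite (ge0_integral_pushforward mshift).
apply: eq_measure_integral => A mA _.
apply/esym/lebesgue_measure_unique => //= _ [[u v]] _ <-.
rewrite /pushforward.
have -> : shift c @^-1` `]u, v] = `]u - c, v - c]%classic.
  by apply/seteqP; split => x /=; rewrite !in_itv/= ltrBlDr lerBrDr.
by rewrite !lebesgue_measure_itv/= !lte_fin ltrD2r -!EFinD opprD addrACA subrr addr0.
Qed.

(** The factor [b] is absorbed into the measure: [b] times the image of Lebesgue measure under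
    multiplication by [b] gives half-open intervals their length. *)
Lemma lebesgue_integral_scale (f : R -> \bar R) (b : R) : 0 < b ->
  measurable_fun setT f -> (forall x, 0 <= f x)%E ->
  (b%:E * \int[mu]_x f (b * x)%R = \int[mu]_x f x)%E.
Proof.
move=> b0 mf f0.
have mscal : measurable_fun setT ( *%R b : measurableTypeR R -> measurableTypeR R).
  exact: measurable_funM.
transitivity (b%:E * \int[pushforward mu
  ( *%R b : measurableTypeR R -> measurableTypeR R)]_x f x)%E.
  by rewrite (ge0_integral_pushforward mscal).
pose nb : {nonneg R} := NngNum (ltW b0).
rewrite -[b]/(nb%:num) -ge0_integral_mscale//.
apply: eq_measure_integral => A mA _.
apply/esym/lebesgue_measure_unique => //= _ [[u v]] _ <-.
rewrite /mscale /= /pushforward.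
have -> : *%R b @^-1` `]u, v] = `](u / b), (v / b)]%classic.
  by apply/seteqP; split => x /=; rewrite !in_itv/= ltr_pdivrMr// ler_pdivlMr// mulrC.
rewrite !lebesgue_measure_itv/= !lte_fin ltr_pM2r ?invr_gt0//.
case: ifPn => _; last by rewrite mule0.
by rewrite -!EFinD -EFinM -mulrBl mulrC divfK ?gt_eqF.
Qed.

End one_dimensional.

(** * Translations, reflections and sums of Gaussian variables *)

Section gaussian_density.
Context {R : realType}.
Local Notation mu := (@lebesgue_measure R).
Local Notation phi := (normal_pdf (0 : R) 1).
Local Notation peak := (normal_peak (1 : R)).

Lemma std_pdfE x : phi x = peak * expR (- (x ^+ 2) / 2).
Proof. by rewrite normal_pdfE ?oner_eq0// /normal_fun subr0 expr1n. Qed.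

Lemma measurable_phi : measurable_fun [set: R] (fun x => (phi x)%:E).
Proof. by apply/measurable_EFinP; exact: measurable_normal_pdf. Qed.

Lemma phi_ge0 x : (0 <= (phi x)%:E)%E.
Proof. by rewrite lee_fin normal_pdf_ge0. Qed.

Lemma lebesgue_integral_opp (f : R -> \bar R) :
  measurable_fun setT f -> (forall x, 0 <= f x)%E ->
  (\int[mu]_x f (- x)%R = \int[mu]_x f x)%E.
Proof.
move=> mf f0.
have mopp : measurable_fun setT (-%R : measurableTypeR R -> measurableTypeR R).
  exact: oppr_measurable.
transitivity (\int[pushforward mu
  (-%R : measurableTypeR R -> measurableTypeR R)]_x f x)%E.
  by rewrite (ge0_integral_pushforward mopp).
by apply: eq_measure_integral => /= A mA _; exact: lebesgue_measureN.
Qed.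

Lemma integral_phi_affine (k d : R) : 0 < k ->
  (\int[mu]_x (phi (k * (x - d))%R)%:E = (k^-1)%:E)%E.
Proof.
move=> k0.
have mk : measurable_fun setT (fun x : R => (phi (k * x)%R)%:E).
  by apply: (measurableT_comp measurable_phi); exact: measurable_funM.
rewrite (lebesgue_integral_shift (f := fun x => (phi (k * x)%R)%:E))//; last first.
  by move=> x; exact: phi_ge0.
rewrite -[LHS]mul1e -[X in (X%:E * _)%E](mulVf (lt0r_neq0 k0)) EFinM -muleA.
rewrite (lebesgue_integral_scale (f := fun x => (phi x)%:E))//.
- by rewrite integral_normal_pdf mule1.
- exact: measurable_phi.
- exact: phi_ge0.
Qed.

(** The exponential is the ratio [phi (x - h) / phi x]; translation invariance of Lebesgue measure
    moves the shift from [f] to the density. *)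
Lemma gexp1_shift (f : R -> \bar R) (h : R) :
  measurable_fun setT f -> (forall x, 0 <= f x)%E ->
  gexp1 (fun x => f (x + h)%R) =
  gexp1 (fun x => f x * (expR (h * x - h ^+ 2 / 2))%:E)%E.
Proof.
move=> mf f0.
have mphih : measurable_fun setT (fun x : R => (phi (x - h)%R)%:E).
  by apply: (measurableT_comp measurable_phi); exact: measurable_funB.
have mexp : measurable_fun setT (fun x : R => (expR (h * x - h ^+ 2 / 2))%:E).
  apply/measurable_EFinP; apply: measurableT_comp => //.
  by apply: measurable_funB => //; exact: measurable_funM.
rewrite gexp1_pdf//; last by apply: measurableT_comp => //; exact: measurable_funD.
rewrite gexp1_pdf//; last 2 first.
- exact: emeasurable_funM.
- by move=> x; rewrite mule_ge0// lee_fin expR_ge0.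
rewrite -(lebesgue_integral_shift (f := fun x => f x * _ * _)%E h); last 2 first.
- by apply: emeasurable_funM; [exact: emeasurable_funM|exact: measurable_phi].
- by move=> x; rewrite !mule_ge0// ?phi_ge0// lee_fin expR_ge0.
apply: eq_integral => x _; rewrite -muleA -EFinM; congr (_ * _%:E)%E.
rewrite !std_pdfE mulrCA -expRD; congr (_ * expR _).
by field.
Qed.

Lemma gexp1_opp (f : R -> \bar R) :
  measurable_fun setT f -> (forall x, 0 <= f x)%E ->
  gexp1 (fun x => f (- x)%R) = gexp1 f.
Proof.
move=> mf f0.
rewrite gexp1_pdf//; last by apply: measurableT_comp.
rewrite gexp1_pdf//.
rewrite -[RHS]lebesgue_integral_opp.
- by apply: eq_integral => x _; rewrite !std_pdfE sqrrN.
- by apply: emeasurable_funM => //; exact: measurable_phi.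
- by move=> x; rewrite mule_ge0// phi_ge0.
Qed.

Lemma gexp1_normr (f : R -> \bar R) (b : R) :
  measurable_fun setT f -> (forall x, 0 <= f x)%E ->
  gexp1 (fun x => f (b * x)%R) = gexp1 (fun x => f (`|b| * x)%R).
Proof.
move=> mf f0; case: (ger0P b) => // _.
rewrite -[RHS]gexp1_opp//.
- by congr gexp1; apply/funext => x; rewrite mulrNN.
- by apply: (measurableT_comp mf); exact: measurable_funM.
Qed.

(** Convolution of Gaussian densities. With [w = a * x + b * y], the joint density of [x] and [w]
    factors into the density of [w], of variance [c ^+ 2], and a Gaussian density in [x] centred at
    [a * w / c ^+ 2], which integrates out. *)
Lemma gexp1_add_pos (f : R -> \bar R) (a b : R) : 0 < b ->
  measurable_fun setT f -> (forall x, 0 <= f x)%E ->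
  gexp1 (fun x => gexp1 (fun y => f (a * x + b * y)%R)) =
  gexp1 (fun z => f (Num.sqrt (a ^+ 2 + b ^+ 2) * z)%R).
Proof.
move=> b0 mf f0; set c := Num.sqrt _.
have ab0 : 0 < a ^+ 2 + b ^+ 2 by rewrite ltr_wpDl ?sqr_ge0 ?exprn_gt0.
have c0 : 0 < c by rewrite sqrtr_gt0.
have c2 : c ^+ 2 = a ^+ 2 + b ^+ 2 by rewrite sqr_sqrtr// ltW.
have mphib : measurable_fun setT (fun x : R => ((phi (x / b))%:E * (b^-1)%:E)%E).
  apply: emeasurable_funM => //; apply: (measurableT_comp measurable_phi).
  exact: measurable_funM.
have phib0 x : (0 <= (phi (x / b))%:E * (b^-1)%:E)%E.
  by rewrite mule_ge0 ?phi_ge0// lee_fin invr_ge0 ltW.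
(* The law of [k] times a standard Gaussian has density [phi (w / k) / k]. *)
have scaleE (k : R) (g : R -> \bar R) :
   0 < k -> measurable_fun setT g -> (forall x, 0 <= g x)%E ->
   gexp1 (fun y => g (k * y)%R) = (\int[mu]_w (g w * ((phi (w / k))%:E * (k^-1)%:E)))%E.
  move=> k0 mg g0.
  have mphik : measurable_fun setT (fun x : R => ((phi (x / k))%:E * (k^-1)%:E)%E).
    apply: emeasurable_funM => //; apply: (measurableT_comp measurable_phi).
    exact: measurable_funM.
  have phik0 x : (0 <= (phi (x / k))%:E * (k^-1)%:E)%E.
    by rewrite mule_ge0 ?phi_ge0// lee_fin invr_ge0 ltW.
  have mgk : measurable_fun setT (fun y => g (k * y)%R).
    by apply: (measurableT_comp mg); exact: measurable_funM.
  rewrite gexp1_pdf//.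
  rewrite -(lebesgue_integral_scale
    (f := fun w => g w * ((phi (w / k))%:E * (k^-1)%:E))%E _ k0); last 2 first.
  - exact: emeasurable_funM.
  - by move=> x; rewrite mule_ge0.
  rewrite -ge0_integralZl_EFin//; last 3 first.
  - by move=> x _; exact: mule_ge0 (g0 _) (phik0 _).
  - apply: emeasurable_funM => //.
    by apply: (measurableT_comp mphik); exact: measurable_funM.
  - exact: ltW.
  apply: eq_integral => x _; rewrite muleCA; congr (_ * _)%E.
  rewrite -!EFinM; congr (_%:E).
  by rewrite (mulrC k x) mulfK ?gt_eqF// mulrCA divff ?gt_eqF// mulr1.
rewrite (scaleE c)//.
have inner x : gexp1 (fun y => f (a * x + b * y)%R) =
   (\int[mu]_w (f w * ((phi ((w - a * x) / b))%:E * (b^-1)%:E)))%E.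
  have mfx : measurable_fun setT (fun y => f (a * x + y)%R).
    by apply: (measurableT_comp mf); exact: measurable_funD.
  rewrite [LHS](scaleE b (fun y => f (a * x + y)%R) b0 mfx (fun y => f0 _)).
  rewrite -[RHS](lebesgue_integral_shift
    (f := fun w => f w * ((phi ((w - a * x) / b))%:E * (b^-1)%:E))%E (a * x)); last 2 first.
  - apply: emeasurable_funM => //.
    by apply: (measurableT_comp mphib); exact: measurable_funB.
  - by move=> y; rewrite mule_ge0.
  by apply: eq_integral => w _; rewrite addrK addrC.
under eq_fun do rewrite inner.
pose F (xw : measurableTypeR R * measurableTypeR R) : \bar R :=
  (f xw.2 * ((phi ((xw.2 - a * xw.1) / b))%:E * (b^-1)%:E))%E.
rewrite /gexp1 (@fubini_tonelli _ _ (measurableTypeR R) (measurableTypeR R) R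
  (normal_prob (0:R) 1) mu F); last 2 first.
- apply: emeasurable_funM; first exact: (measurableT_comp mf).
  apply: (measurableT_comp mphib); apply: measurable_funB => //.
  exact: measurable_funM.
- by move=> x; rewrite /F mule_ge0.
apply: eq_integral => w _.
have mx : measurable_fun setT (fun x : R => ((phi ((w - a * x) / b))%:E * (b^-1)%:E)%E).
  apply: (measurableT_comp mphib).
  by apply: measurable_funB; [exact: measurable_cst|exact: measurable_funM].
transitivity (f w *
    gexp1 (fun x => (phi ((w - a * x) / b))%:E * (b^-1)%:E))%E.
  have := @ge0_integralZl _ (measurableTypeR R) R (normal_prob (0:R) 1) setT
    measurableT _ mx (f w).
  by apply=> // x _; exact: phib0.
congr (_ * _)%E; rewrite gexp1_pdf; last 2 first.
- exact: mx.
- by move=> x; exact: phib0.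
have cb0 : 0 < c / b by rewrite divr_gt0.
(* Given [w], the standard deviation of [x] is [b / c]; the last factor therefore integrates to
   [b / c] and leaves [phi (w / c) / c]. *)
transitivity (\int[mu]_x ((phi (w / c) / b)%:E *
    (phi (c / b * (x - a * w / c ^+ 2)))%:E))%E.
  apply: eq_integral => x _.
  rewrite -!EFinM; congr (_%:E).
  rewrite !std_pdfE.
  (* Completing the square in [x]. *)
  rewrite [LHS](_ : _ = peak * peak / b * 
    (expR (- ((w - a * x) / b) ^+ 2 / 2) * expR (- x ^+ 2 / 2))); last by ring.
  rewrite [RHS](_ : _ = peak * peak / b * 
    (expR (- (w / c) ^+ 2 / 2) *
     expR (- (c / b * (x - a * w / c ^+ 2)) ^+ 2 / 2))); last by ring.
  congr (_ * _); rewrite -!expRD; congr expR.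
  suff : ((w - a * x) / b) ^+ 2 + x ^+ 2 =
    (w / c) ^+ 2 + (c / b * (x - a * w / c ^+ 2)) ^+ 2.
    by move=> e; rewrite -!mulrDl -!opprD e.
  have bn0 : b != 0 by rewrite gt_eqF.
  have cn0 : c != 0 by rewrite gt_eqF.
  rewrite [RHS](_ : _ = w ^+ 2 / c ^+ 2 + c ^+ 2 / b ^+ 2 * (x - a * w / c ^+ 2) ^+ 2);
    last by field; rewrite ?bn0 ?cn0.
  rewrite c2; field; rewrite bn0/=; lra.
rewrite ge0_integralZl_EFin//; last 3 first.
- by move=> x _; exact: phi_ge0.
- apply: (measurableT_comp measurable_phi); apply: measurable_funM => //.
  exact: measurable_funB.
- by rewrite divr_ge0 ?normal_pdf_ge0// ltW.
rewrite integral_phi_affine// -!EFinM; congr (_%:E).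
by rewrite invfM invrK; field; rewrite !gt_eqF.
Qed.

(** A nonzero [b] may be replaced by its absolute value, since the standard Gaussian is symmetric;
    for [b = 0] the inner expectation is that of a constant. *)
Lemma gexp1_add (f : R -> \bar R) (a b : R) :
  measurable_fun setT f -> (forall x, 0 <= f x)%E ->
  gexp1 (fun x => gexp1 (fun y => f (a * x + b * y)%R)) =
  gexp1 (fun z => f (Num.sqrt (a ^+ 2 + b ^+ 2) * z)%R).
Proof.
move=> mf f0; have [->|b0] := eqVneq b 0.
  rewrite expr0n addr0 sqrtr_sqr -gexp1_normr//.
  congr gexp1; apply/funext => x.
  by under eq_fun do rewrite mul0r addr0; rewrite gexp1_cst.
rewrite -(real_normK (num_real b)) -gexp1_add_pos ?normr_gt0//.
congr gexp1; apply/funext => x.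
rewrite (gexp1_normr (f := fun y => f (a * x + y)%R))//.
by apply: (measurableT_comp mf); exact: measurable_funD.
Qed.

End gaussian_density.

(** * Iterated Gaussian expectation *)

Section gaussian_tuples.
Context {R : realType}.

Lemma gexp_ge0 n (f : n.-tuple R -> \bar R) :
  (forall t, 0 <= f t)%E -> (0 <= gauss_exp f)%E.
Proof.
elim: n f => [|n IH] f f0 /=; first exact: f0.
by apply: gexp1_ge0 => x; apply: IH => t; exact: f0.
Qed.

Lemma measurable_cons_pair n :
  measurable_fun setT (fun xu : R * n.-tuple R => cons_tuple xu.1 xu.2).
Proof. exact: measurable_cons. Qed.

(** The parameter space is arbitrary so that the induction can move the coordinate just peeled off
    into the parameter. *)
Lemma measurable_gexp n d (T : measurableType d) (f : T * n.-tuple R -> \bar R) :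
  measurable_fun setT f -> (forall x, 0 <= f x)%E ->
  measurable_fun setT (fun t => gauss_exp (fun u => f (t, u))).
Proof.
elim: n d T f => [|n IH] d T f mf f0 /=.
  by apply: (measurableT_comp mf); exact: measurable_fun_pair.
apply: (measurable_gexp1
  (f := fun tx : T * R => gauss_exp (fun u => f (tx.1, cons_tuple tx.2 u)))).
- apply: (IH _ _ (fun txu : (T * R) * n.-tuple R =>
    f (txu.1.1, cons_tuple txu.1.2 txu.2))) => //.
  apply: (measurableT_comp mf); apply: measurable_fun_pair.
    by apply: measurableT_comp.
  by apply: measurable_cons => //; exact: measurableT_comp.
- by move=> tx; apply: gexp_ge0.
Qed.

Lemma measurable_comp_cons n (f : n.+1.-tuple R -> \bar R) (x : R) :
  measurable_fun setT f -> measurable_fun setT (fun u => f (cons_tuple x u)).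
Proof.
by move=> mf; apply: (measurableT_comp mf); apply: measurable_cons.
Qed.

Lemma measurable_gexp_cons n (f : n.+1.-tuple R -> \bar R) :
  measurable_fun setT f -> (forall t, 0 <= f t)%E ->
  measurable_fun setT (fun x : R => gauss_exp (fun u => f (cons_tuple x u))).
Proof.
move=> mf f0.
apply: (measurable_gexp (f := fun xu : R * n.-tuple R => f (cons_tuple xu.1 xu.2))) => //.
by apply: (measurableT_comp mf); exact: measurable_cons_pair.
Qed.

Lemma gexp_cst n (c : \bar R) : gauss_exp (fun _ : n.-tuple R => c) = c.
Proof.
elim: n => [//|n IH] /=.
by under eq_integral do rewrite IH; exact: gexp1_cst.
Qed.

Lemma eq_gexp n (f g : n.-tuple R -> \bar R) : f =1 g -> gauss_exp f = gauss_exp g.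
Proof. by move=> /funext ->. Qed.

Lemma gexpD n (f g : n.-tuple R -> \bar R) :
  measurable_fun setT f -> measurable_fun setT g ->
  (forall t, 0 <= f t)%E -> (forall t, 0 <= g t)%E ->
  gauss_exp (fun t => f t + g t)%E = (gauss_exp f + gauss_exp g)%E.
Proof.
elim: n f g => [//|n IH] f g mf mg f0 g0 /=.
rewrite -gexp1D; first last.
- by move=> x; apply: gexp_ge0.
- by move=> x; apply: gexp_ge0.
- exact: measurable_gexp_cons.
- exact: measurable_gexp_cons.
by congr gexp1; apply/funext => x; rewrite IH//; exact: measurable_comp_cons.
Qed.

Lemma gexpZl n (k : R) (f : n.-tuple R -> \bar R) :
  measurable_fun setT f -> (forall t, 0 <= f t)%E -> 0 <= k ->
  gauss_exp (fun t => k%:E * f t)%E = (k%:E * gauss_exp f)%E.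
Proof.
move=> + + k0; elim: n f => [//|n IH] f mf f0 /=.
rewrite -gexp1Zl//; first last.
- by move=> x; apply: gexp_ge0.
- exact: measurable_gexp_cons.
by congr gexp1; apply/funext => x; rewrite IH//; exact: measurable_comp_cons.
Qed.

Lemma gexp_le n (f g : n.-tuple R -> \bar R) :
  measurable_fun setT f -> measurable_fun setT g ->
  (forall t, 0 <= f t)%E -> (forall t, f t <= g t)%E ->
  (gauss_exp f <= gauss_exp g)%E.
Proof.
elim: n f g => [|n IH] f g mf mg f0 fg /=; first exact: fg.
have g0 t : (0 <= g t)%E by exact: le_trans (f0 t) (fg t).
apply: gexp1_le.
- exact: measurable_gexp_cons.
- exact: measurable_gexp_cons.
- by move=> x; apply: gexp_ge0.
- by move=> x; apply: IH => //; exact: measurable_comp_cons.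
Qed.

Lemma gexp_sum n (I : finType) (f : I -> n.-tuple R -> \bar R) :
  (forall i, measurable_fun setT (f i)) -> (forall i t, 0 <= f i t)%E ->
  gauss_exp (fun t => \sum_(i : I) f i t)%E = (\sum_(i : I) gauss_exp (f i))%E.
Proof.
move=> mf f0; elim: (index_enum I) => [|i l IH].
  by rewrite big_nil -[RHS](gexp_cst n); apply: eq_gexp => t; rewrite big_nil.
rewrite big_cons -IH -gexpD//.
- by apply: eq_gexp => t; rewrite big_cons.
- exact: emeasurable_sum.
- by move=> t; apply: sume_ge0.
Qed.

Lemma gexp_swap n (f : R * n.-tuple R -> \bar R) :
  measurable_fun setT f -> (forall x, 0 <= f x)%E ->
  gexp1 (fun x => gauss_exp (fun t => f (x, t))) =
  gauss_exp (fun t => gexp1 (fun x => f (x, t))).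
Proof.
elim: n f => [//|n IH] f mf f0 /=.
have mf2 : measurable_fun setT (fun p : (R * R) * n.-tuple R =>
    f (p.1.1, cons_tuple p.1.2 p.2)).
  apply: (measurableT_comp mf); apply: measurable_fun_pair.
    exact: measurableT_comp.
  by apply: measurable_cons => //; exact: measurableT_comp.
rewrite -/(gexp1 _) (gexp1_swap (f := fun xy : R * R =>
  gauss_exp (fun t => f (xy.1, cons_tuple xy.2 t)))); last 2 first.
- exact: (measurable_gexp mf2).
- by move=> x; apply: gexp_ge0.
congr gexp1; apply/funext => y.
apply: (IH (fun xt => f (xt.1, cons_tuple y xt.2))) => //.
apply: (measurableT_comp mf); apply: measurable_fun_pair => //.
by apply: measurable_cons.
Qed.

Lemma gexp_cat m k (f : (m + k).-tuple R -> \bar R) :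
  gauss_exp f = gauss_exp (fun u : m.-tuple R =>
    gauss_exp (fun v : k.-tuple R => f (cat_tuple u v))).
Proof.
elim: m f => [|m IH] f /=.
  by apply: eq_gexp => v; congr f; exact: val_inj.
congr gexp1; apply/funext => x; rewrite IH.
by apply: eq_gexp => u; apply: eq_gexp => v; congr f; exact: val_inj.
Qed.

Lemma gexp_nth p (j : nat) (h : R -> \bar R) : (j < p)%N ->
  gauss_exp (fun t : p.-tuple R => h (nth 0 t j)) = gexp1 h.
Proof.
elim: p j => [//|p IH] [|j] jp /=.
  by congr gexp1; apply/funext => x; rewrite gexp_cst.
by under eq_integral do rewrite IH//; exact: gexp1_cst.
Qed.

(* Coordinates [i * p + j] form the [j]-th column of a row-major [n] x [p] matrix. *)
Lemma gexp_column n p (j : nat) (g : seq R -> \bar R) : (j < p)%N ->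
  gauss_exp (fun t : (n * p).-tuple R => g [seq nth 0 t (i * p + j) | i <- iota 0 n]) =
  gauss_exp (fun t : n.-tuple R => g t).
Proof.
move=> jp; elim: n g => [|n IH] g; first by [].
(* The first [p] coordinates form the first row, of which only entry [j] matters; the remaining rows
   are treated by induction. *)
rewrite (gexp_cat (m := p) (k := n * p)).
transitivity (gauss_exp (fun u : p.-tuple R =>
   gauss_exp (fun w : n.-tuple R => g (nth 0 u j :: w)))).
  apply: eq_gexp => u; rewrite -(IH (fun w => g (nth 0 u j :: w))).
  apply: eq_gexp => v; congr g => /=.
  rewrite mul0n add0n nth_cat size_tuple jp; congr cons.
  rewrite (iotaDl 1 0 n) -map_comp; apply: eq_map => i /=.
  rewrite nth_cat size_tuple ltnNge add1n mulSn -addnA leq_addr/=.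
  by rewrite addKn.
by rewrite (gexp_nth (fun x => gauss_exp (fun w : n.-tuple R => g (x :: w)))).
Qed.

End gaussian_tuples.

(** * Gaussian vectors: shifts, linear forms and null sets *)

Section gaussian_vectors.
Context {R : realType}.

Definition tdot n (u v : n.-tuple R) : R := \sum_(i < n) tnth u i * tnth v i.

Definition tadd n (u v : n.-tuple R) : n.-tuple R :=
  [tuple tnth u i + tnth v i | i < n].

Lemma tdot_cons n (x y : R) (u v : n.-tuple R) :
  tdot (cons_tuple x u) (cons_tuple y v) = x * y + tdot u v.
Proof.
rewrite /tdot big_ord_recl !tnth0; congr (_ + _).
by apply: eq_bigr => i _; rewrite !tnthS.
Qed.

Lemma tadd_cons n (x y : R) (u v : n.-tuple R) :
  tadd (cons_tuple x u) (cons_tuple y v) = cons_tuple (x + y) (tadd u v).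
Proof.
apply: eq_from_tnth => i; rewrite tnth_mktuple.
by case: (unliftP ord0 i) => [k|] ->; rewrite ?tnthS ?tnth0// tnth_mktuple.
Qed.

Lemma tdot_ge0 n (u : n.-tuple R) : 0 <= tdot u u.
Proof. by apply: sumr_ge0 => i _; rewrite -expr2 sqr_ge0. Qed.

Lemma measurable_tdot n (u : n.-tuple R) : measurable_fun setT (tdot u).
Proof.
apply: measurable_sum => i; apply: measurable_funM => //.
exact: measurable_tnth.
Qed.

Lemma measurable_density n (h : n.-tuple R) :
  measurable_fun setT (fun t => (expR (tdot h t - tdot h h / 2))%:E).
Proof.
apply/measurable_EFinP; apply: measurableT_comp => //.
by apply: measurable_funB => //; exact: measurable_tdot.
Qed.

(* The Cameron-Martin formula. *)
Lemma gexp_shift n (f : n.-tuple R -> \bar R) (h : n.-tuple R) :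
  measurable_fun setT f -> (forall t, 0 <= f t)%E ->
  gauss_exp (fun t => f (tadd t h)) =
  gauss_exp (fun t => f t * (expR (tdot h t - tdot h h / 2))%:E)%E.
Proof.
elim: n f h => [|n IH] f h mf f0 /=.
  rewrite /tdot !big_ord0 mul0r subrr expR0 mule1.
  by congr f; rewrite [LHS]tuple0 [RHS]tuple0.
(* [G] already contains the density for the tail [h]; what is left is the one-dimensional shift by
   [h0] in the head. *)
case/tupleP: h => h0 h.
pose G (y : R) : \bar R := gauss_exp (fun t =>
  f (cons_tuple y t) * (expR (tdot h t - tdot h h / 2))%:E)%E.
have mG0 (y : R) : measurable_fun setT (fun t =>
    f (cons_tuple y t) * (expR (tdot h t - tdot h h / 2))%:E)%E.
  apply: emeasurable_funM; first exact: measurable_comp_cons.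
  exact: measurable_density.
have G00 y t : (0 <= f (cons_tuple y t) * (expR (tdot h t - tdot h h / 2))%:E)%E.
  by rewrite mule_ge0// lee_fin expR_ge0.
transitivity (gexp1 (fun x => G (x + h0))).
  congr gexp1; apply/funext => x; rewrite /G -(IH (fun t => f (cons_tuple (x + h0) t))).
  - by apply: eq_gexp => t; rewrite -tadd_cons.
  - exact: measurable_comp_cons.
  - by move=> t; exact: f0.
rewrite gexp1_shift.
- congr gexp1; apply/funext => x; rewrite /G muleC -gexpZl ?expR_ge0//.
  apply: eq_gexp => t; rewrite muleCA -EFinM -expRD.
  rewrite -/(cons_tuple h0 h) !tdot_cons; congr (_ * (expR _)%:E)%E.
  by rewrite mulrDl expr2; ring.
- apply: (measurable_gexp (f := fun yt : R * n.-tuple R =>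
   f (cons_tuple yt.1 yt.2) * (expR (tdot h yt.2 - tdot h h / 2))%:E)%E).
  + apply: emeasurable_funM.
      by apply: (measurableT_comp mf); exact: measurable_cons_pair.
    exact: (measurableT_comp (measurable_density h)).
  + by move=> [y t]; exact: G00.
- by move=> y; exact: gexp_ge0.
Qed.

(** By induction the later terms act as one Gaussian of standard deviation [Num.sqrt (tdot h h)],
    which [gexp1_add] merges with the first term. This makes the likelihood-ratio test
    one-dimensional. *)
Lemma gexp_dot n (f : R -> \bar R) (h : n.-tuple R) :
  measurable_fun setT f -> (forall x, 0 <= f x)%E ->
  gauss_exp (fun t => f (tdot h t)) =
  gexp1 (fun z => f (Num.sqrt (tdot h h) * z)%R).
Proof.
move=> + +; elim: n f h => [|n IH] f h mf f0 /=.
  rewrite /tdot !big_ord0 sqrtr0.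
  by under eq_fun do rewrite mul0r; rewrite gexp1_cst.
case/tupleP: h => h0 h; rewrite -/(cons_tuple h0 h) tdot_cons.
transitivity (gexp1 (fun x => gexp1 (fun z => f (h0 * x + Num.sqrt (tdot h h) * z)))).
  congr gexp1; apply/funext => x; rewrite -(IH (fun y => f (h0 * x + y)%R))//.
    by apply: eq_gexp => t; rewrite tdot_cons.
  by apply: (measurableT_comp mf); exact: measurable_funD.
by rewrite gexp1_add// sqr_sqrtr ?tdot_ge0// -expr2.
Qed.

Lemma gexp1_null (f g : R -> \bar R) :
  measurable_fun setT f -> measurable_fun setT g ->
  (forall x, 0 <= f x)%E -> (forall x, 0 <= g x)%E ->
  (forall x, x != 0 -> f x = g x) -> gexp1 f = gexp1 g.
Proof.
move=> mf mg f0 g0 fg; apply: ge0_ae_eq_integral => //.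
exists [set 0]; split => //.
- have /null_content_dominatesP := @normal_prob_dominates R 0 1.
  by apply=> //; exact: lebesgue_measure_set1.
- move=> x /= /not_implyP[_]; apply: contra_notP => /eqP x0; exact: fg.
Qed.

(** The hyperplane where the first coordinate vanishes is Gaussian-null. This serves to discard zero
    columns of the design. *)
Lemma gexp_null n (f g : n.+1.-tuple R -> \bar R) :
  measurable_fun setT f -> measurable_fun setT g ->
  (forall t, 0 <= f t)%E -> (forall t, 0 <= g t)%E ->
  (forall t, thead t != 0 -> f t = g t) -> gauss_exp f = gauss_exp g.
Proof.
move=> mf mg f0 g0 fg /=; apply: gexp1_null.
- exact: measurable_gexp_cons.
- exact: measurable_gexp_cons.
- by move=> x; exact: gexp_ge0.
- by move=> x; exact: gexp_ge0.
- by move=> x x0; apply: eq_gexp => t; apply: fg; rewrite theadE.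
Qed.

End gaussian_vectors.

(** * Bernoulli sampling of subsets *)

Section subset_sampling.
Context {R : realType} (p : nat) (q : R).
Hypothesis q01 : 0 <= q <= 1.
Implicit Types (A : {set 'I_p}) (G : {set 'I_p} -> R).

(** The probability that independent Bernoulli([q]) draws select exactly the set [A]. *)
Definition bern_wt A : R := \prod_(i < p) (if i \in A then q else 1 - q).

Lemma bern_wt_ge0 A : 0 <= bern_wt A.
Proof.
case/andP: q01 => q0 q1; apply: prodr_ge0 => i _.
by case: ifP => // _; rewrite subr_ge0.
Qed.

(** Expanding the product of [p] equal factors yields one term per subset: this is the generating
    function of the binomial law. *)
Lemma bern_wt_gen (x : R) : \sum_A bern_wt A * x ^+ #|A| = (q * x + (1 - q)) ^+ p.
Proof.
rewrite -[in RHS](card_ord p) -prodr_const.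
rewrite (bigA_distr 1 +%R) /=; apply: eq_bigr => A _.
rewrite -prodr_const [X in _ * X]big_mkcond -big_split /=.
by apply: eq_bigr => i _; case: ifP; rewrite ?mulr1.
Qed.

Lemma bern_wt_sum : \sum_A bern_wt A = 1.
Proof.
have := bern_wt_gen 1; rewrite mulr1 addrC subrK expr1n => <-.
by apply: eq_bigr => A _; rewrite expr1n mulr1.
Qed.

Lemma sum_set_split G (j : 'I_p) :
  \sum_A G A = \sum_(A : {set 'I_p} | j \notin A) (G A + G (j |: A)).
Proof.
rewrite (bigID (fun A : {set 'I_p} => j \in A)) /= big_split addrC; congr (_ + _).
rewrite (reindex_onto (fun A : {set 'I_p} => j |: A) (fun A => A :\ j)) /=; last first.
  by move=> A jA; rewrite finset.setD1K.
apply: eq_bigl => A; rewrite finset.setU11 /=.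
apply/eqP/idP => [<-|jA]; first by rewrite !inE eqxx.
by rewrite finset.setU1K.
Qed.

(** Membership of [j] is independent of the rest of the set, so it may be drawn afresh. In the new
    terms [A] matters only outside [j], so that the two hypotheses on coordinate [j] share the same
    remaining support. *)
Lemma bern_wt_resample G (j : 'I_p) :
  \sum_A bern_wt A * G A =
  \sum_A bern_wt A * ((1 - q) * G (A :\ j) + q * G (j |: A)).
Proof.
rewrite (sum_set_split _ j) [RHS](sum_set_split _ j); apply: eq_bigr => A jA.
have [v E0 E1] : exists2 v, bern_wt A = (1 - q) * v & bern_wt (j |: A) = q * v.
  exists (\prod_(i < p | i != j) (if i \in A then q else 1 - q)).
    by rewrite /bern_wt (bigD1 j)//= (negPf jA).
  rewrite /bern_wt (bigD1 j)//= finset.setU11; congr (_ * _).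
  by apply: eq_bigr => i ij; rewrite !inE (negPf ij).
have -> : A :\ j = A by apply/finset.setDidPl; rewrite disjoint_sym disjoints1.
have -> : j |: (j |: A) = j |: A by rewrite finset.setUA finset.setUid.
have -> : (j |: A) :\ j = A by rewrite finset.setU1K.
by rewrite E0 E1; ring.
Qed.

(** Markov's inequality for [expR (lam * #|A|)], whose mean is the [p]-th power of
    [q * expR lam + (1 - q)], followed by [1 + y <= expR y]. *)
Lemma bern_wt_chernoff (s : nat) (lam : R) : 0 <= lam ->
  \sum_(A : {set 'I_p}) bern_wt A * (s <= #|A|)%:R
   <= expR (p%:R * q * (expR lam - 1) - lam * s%:R).
Proof.
move=> lam0; case/andP: q01 => q0 q1.
have e1 : 1 <= expR lam by rewrite -expR0 ler_expR.
apply: (@le_trans _ _ (\sum_A bern_wt A * expR lam ^+ #|A| * expR (- (lam * s%:R)))).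
  apply: ler_sum => A _; rewrite -mulrA ler_wpM2l ?bern_wt_ge0//.
  rewrite -expRM_natl -expRD; case: leqP => sA; last exact: expR_ge0.
  rewrite -[leLHS]expR0 ler_expR -[leRHS]opprK oppr_ge0.
  by rewrite opprD opprK addrC subr_le0 mulrC ler_wpM2r// ler_nat.
rewrite -mulr_suml bern_wt_gen expRD ler_wpM2r ?expR_ge0//.
rewrite -(mulrA p%:R) (mulrC p%:R) expRM_natr.
apply: lerXn2r; rewrite ?nnegrE ?expR_ge0//.
  by rewrite addr_ge0 ?subr_ge0// mulr_ge0// expR_ge0.
by apply: le_trans (expR_ge1Dx _); lra.
Qed.

End subset_sampling.


(** The left side is 1 at 0 and its derivative is [- (x ^+ 2) * expR (x + x ^+ 2 / 2)]. For [x < 1]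
    this is the lower bound [x + x ^+ 2 / 2] on [- ln (1 - x)]. *)
Lemma expR_quadratic_bound {R : realType} (x : R) : 0 <= x ->
  (1 - x) * expR (x + x ^+ 2 / 2) <= 1.
Proof.
move=> x0; pose g (y : R) : R := (1 - y) * expR (y + y ^+ 2 / 2).
have dg (y : R) : is_derive y 1 g (- (y ^+ 2) * expR (y + y ^+ 2 / 2)).
  rewrite /g; apply: is_derive_eq.
  by rewrite /= !scaler1 !scaler0 /GRing.scale /=; field.
have g0 : g 0 = 1 by rewrite /g expr0n/= mul0r addr0 expR0; ring.
suff : g x <= g 0 by rewrite g0.
apply: (@ler0_derive1_le_cc R g 0 x); rewrite ?in_itv/= ?lexx//.
- move=> z _; rewrite derive1E; have [_ ->] := dg z.
  by rewrite mulNr oppr_le0 mulr_ge0 ?sqr_ge0 ?expR_ge0.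
- by apply: derivable_within_continuous => z _; have [] := dg z.
- by rewrite x0.
Qed.

(** * Large deviations of the size of the random support *)

Section sample_size.
Context {R : realType} (p s : nat) (s' : R).
Hypotheses (s_gt0 : (0 < s)%N) (sp : (s < p)%N) (s'0 : 0 < s') (s's : s' <= s%:R).
Local Notation q := (s' / p%:R).

Let p0 : 0 < p%:R :> R. Proof. by rewrite ltr0n (leq_trans _ sp). Qed.
Let s0 : 0 < s%:R :> R. Proof. by rewrite ltr0n. Qed.

Lemma sample_prob01 : 0 <= q <= 1.
Proof.
apply/andP; split; first by rewrite divr_ge0// ltW.
by rewrite ler_pdivrMr// mul1r (le_trans s's)// ler_nat ltnW.
Qed.

Lemma bern_wt_tail :
  \sum_(A : {set 'I_p}) bern_wt q A * (s <= #|A|)%:R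
   <= expR (- (s%:R - s') ^+ 2 / (2 * s%:R)).
Proof.
(* The best Chernoff parameter is [- ln (1 - x) = ln (s / s')]; its second-order expansion
   [x + x ^+ 2 / 2] suffices. As [p * q = s * (1 - x)], the exponent is at most
   [s * (x - (x + x ^+ 2 / 2))]. *)
pose x : R := 1 - s' / s%:R.
have x0 : 0 <= x by rewrite subr_ge0 ler_pdivrMr// mul1r.
have lam0 : 0 <= x + x ^+ 2 / 2 by rewrite addr_ge0// divr_ge0// sqr_ge0.
apply: le_trans (@bern_wt_chernoff R p q sample_prob01 s _ lam0) _.
rewrite ler_expR mulrCA divff ?gt_eqF// mulr1.
have -> : - (s%:R - s') ^+ 2 / (2 * s%:R) = s%:R * (- (x ^+ 2 / 2)).
  by rewrite /x; field; rewrite gt_eqF.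
have s'E : s' = s%:R * (1 - x) by rewrite /x; field; rewrite gt_eqF.
rewrite s'E -mulrA [_ * s%:R]mulrC -mulrBr ler_pM2l//.
have := expR_quadratic_bound x0; set e := expR _; nra.
Qed.

(** When [#|A| > s], the factor [2 * s + #|A|] is at most [3 * #|A|], and [#|A|] counts the
    memberships [j \in A]. Resampling [j] extracts a factor [q], and over the [p] indices these add
    up to [s']. *)
Lemma bern_wt_excess :
  \sum_(A : {set 'I_p} | (s < #|A|)%N) bern_wt q A * (2 * s + #|A|)%:R
   <= 3 * s' * expR (- (s%:R - s') ^+ 2 / (2 * s%:R)).
Proof.
have wt0 := bern_wt_ge0 sample_prob01.
have [q0 q1] := andP sample_prob01.
apply: (@le_trans _ _ (3 * \sum_(A : {set 'I_p}) bern_wt q A * (#|A| * (s < #|A|)%N)%:R)).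
  rewrite mulr_sumr big_mkcond; apply: ler_sum => A _.
  case: ltnP => sA; last by rewrite muln0 !mulr0.
  rewrite mulrCA -natrM ler_wpM2l// muln1 ler_nat; lia.
rewrite -mulrA ler_wpM2l//.
have -> : \sum_(A : {set 'I_p}) bern_wt q A * (#|A| * (s < #|A|)%N)%:R =
    \sum_(j < p) \sum_(A : {set 'I_p}) bern_wt q A * ((j \in A) && (s < #|A|)%N)%:R.
  rewrite exchange_big; apply: eq_bigr => A _.
  rewrite -mulr_sumr -natr_sum; congr (_ * _%:R).
  rewrite -sum1_card big_distrl/= big_mkcond/=.
  by apply: eq_bigr => j _; case: (j \in A); rewrite //= mul1n.
apply: (@le_trans _ _
  (\sum_(j < p) q * expR (- (s%:R - s') ^+ 2 / (2 * s%:R)))); last first.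
  by rewrite sumr_const card_ord -[_ *+ p]mulr_natl mulrA (mulrC p%:R) divfK// gt_eqF.
apply: ler_sum => j _; rewrite (bern_wt_resample q _ j).
apply: le_trans (ler_wpM2l q0 bern_wt_tail).
rewrite mulr_sumr; apply: ler_sum => A _.
rewrite mulrCA ler_wpM2l// !inE eqxx/= mulr0 add0r ler_wpM2l// ler_nat.
(* Adding one index to [A] gives more than [s] elements only if [s <= #|A|]; this is why the tail
   bound has a weak inequality. *)
case: ltnP => //= sA; rewrite lt0b.
by move: sA; rewrite cardsU1; case: (j \in A) => /=; lia.
Qed.
End sample_size.

(** * Testing two shifts of a Gaussian vector *)

Section indicators.
Context {R : realType}.

Definition ind (b : bool) : \bar R := (b%:R)%:E.

Lemma ind_ge0 b : (0 <= ind b)%E. Proof. by rewrite lee_fin. Qed.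

Lemma measurable_ind d (T : measurableType d) (P : T -> bool) :
  measurable_fun setT P -> measurable_fun setT (fun t => ind (P t)).
Proof.
move=> mP; rewrite (_ : (fun t => _) = fun t => if P t then 1%E else 0%E).
  exact: measurable_fun_ifT.
by apply/funext => t; rewrite /ind; case: (P t).
Qed.

Lemma indic_ind T (P : T -> bool) (t : T) :
  (\1_[set t | P t] t)%:E = ind (P t).
Proof.
rewrite indicE /ind; congr ((nat_of_bool _)%:R)%:E.
by apply/idP/idP; rewrite inE.
Qed.

Lemma measurable_sqrtr : measurable_fun [set: R] (Num.sqrt : R -> R).
Proof. by apply: nondecreasing_measurable => // x y; exact: ler_wsqrtr. Qed.

Lemma measurable_invr : measurable_fun [set: R] (fun x : R => x^-1).
Proof.
(* The real power of exponent [-1] is rewritten as an inverse for a nonnegative base, whence the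
   square; at 0 both sides are 0. *)
rewrite (_ : (fun x : R => _) = fun x : R => x * ((x ^+ 2) `^ (-1))).
  apply: measurable_funM => //.
  apply: (measurableT_comp (measurable_powR (-1))); exact: measurable_funX.
apply/funext => x; rewrite powR_inv1 ?sqr_ge0//.
have [->|x0] := eqVneq x 0; first by rewrite invr0 mul0r.
by rewrite expr2 invfM mulrA divff// mul1r.
Qed.

End indicators.

Section testing.
Context {R : realType} (n : nat) (h : n.-tuple R) (c0 c1 : R).
Hypotheses (c0_gt0 : 0 < c0) (c1_gt0 : 0 < c1).
Implicit Types T : n.-tuple R -> bool.

(** Density of the law of [Z + h] with respect to that of the standard Gaussian vector [Z]. *)
Definition likelihood (t : n.-tuple R) : R := expR (tdot h t - tdot h h / 2).

(** Cameron-Martin brings the error under the shifted law back to the centred one, so that both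
    errors stand under one integral. *)
Lemma test_riskE T : measurable_fun setT T ->
  (c0%:E * gauss_exp (fun t => ind (T t))
   + c1%:E * gauss_exp (fun t => ind (~~ T (tadd t h))) =
   gauss_exp (fun t =>
     c0%:E * ind (T t) + c1%:E * (ind (~~ T t) * (likelihood t)%:E)))%E.
Proof.
move=> mT; have mL := measurable_density h.
have mI := measurable_ind (R := R) mT.
have mN := measurable_ind (R := R) (measurable_neg mT).
have p0 t : (0 <= ind (~~ T t) * (likelihood t)%:E)%E.
  by rewrite mule_ge0 ?ind_ge0// lee_fin expR_ge0.
have mp : measurable_fun setT (fun t => ind (~~ T t) * (likelihood t)%:E)%E.
  exact: emeasurable_funM.
rewrite (gexp_shift h mN (fun _ => ind_ge0 _)) gexpD.
- rewrite (gexpZl mI (fun _ => ind_ge0 _) (ltW c0_gt0)).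
  by rewrite (gexpZl mp p0 (ltW c1_gt0)).
- exact: emeasurable_funM.
- exact: emeasurable_funM.
- by move=> t; rewrite mule_ge0 ?ind_ge0// lee_fin ltW.
- by move=> t; rewrite mule_ge0// lee_fin ltW.
Qed.

(** At each [t] a test pays [c0] when it answers true and [c1 * likelihood t] otherwise. The test
    that always pays the smaller amount depends on [t] only through [tdot h t], a Gaussian of
    standard deviation [d]. *)
Lemma neyman_pearson T (d : R) :
  measurable_fun setT T -> d = Num.sqrt (tdot h h) ->
  (c0%:E * gexp1 (fun x => ind (d ^+ 2 / 2 + ln (c0 / c1) < d * x)%R)
   + c1%:E * gexp1 (fun x => ind (d ^+ 2 / 2 - ln (c0 / c1) <= d * x)%R) <=
   c0%:E * gauss_exp (fun t => ind (T t))
   + c1%:E * gauss_exp (fun t => ind (~~ T (tadd t h))))%E.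
Proof.
move=> mT dE; set k := ln _.
have d2 : d ^+ 2 = tdot h h by rewrite dE sqr_sqrtr ?tdot_ge0.
(* [S] is the likelihood-ratio test [c1 * likelihood > c0]. *)
pose S (t : n.-tuple R) := d ^+ 2 / 2 + k < tdot h t.
have mS : measurable_fun setT S.
  by apply: measurable_fun_ltr => //; exact: measurable_tdot.
have gd (f : R -> \bar R) : measurable_fun setT f -> (forall x, 0 <= f x)%E ->
    gauss_exp (fun t => f (tdot h t)) = gexp1 (fun z => f (d * z)).
  by rewrite dE; exact: gexp_dot.
have mlin (c : R) : measurable_fun setT (fun x : R => c * x) by exact: measurable_funM.
have -> : gexp1 (fun x => ind (d ^+ 2 / 2 + k < d * x)%R) =
    gauss_exp (fun t => ind (S t)).
  rewrite -(gd (fun y => ind (d ^+ 2 / 2 + k < y)%R))//.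
  - by apply: measurable_ind; apply: measurable_fun_ltr.
  - by move=> x; exact: ind_ge0.
have -> : gexp1 (fun x => ind (d ^+ 2 / 2 - k <= d * x)%R) =
    gauss_exp (fun t => ind (~~ S (tadd t h))).
  (* Under the shifted law [S] misses when [d * x + d ^+ 2 <= d ^+ 2 / 2 + k]; reflecting [x] gives
     the stated form. *)
  rewrite -gexp1_opp; last 2 first.
  - by apply: measurable_ind; apply: measurable_fun_ler.
  - by move=> x; exact: ind_ge0.
  transitivity (gexp1 (fun x => ind (d * x <= k - d ^+ 2 / 2)%R)).
    congr gexp1; apply/funext => x; congr ind.
    by rewrite mulrN -[in RHS]lerN2 opprB.
  rewrite -(gd (fun y => ind (y <= k - d ^+ 2 / 2)%R)); last 2 first.
  - by apply: measurable_ind; apply: measurable_fun_ler.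
  - by move=> x; exact: ind_ge0.
  apply: eq_gexp => t; congr ind; rewrite /S -leNgt.
  have -> : tdot h (tadd t h) = tdot h t + tdot h h.
    rewrite /tdot -big_split /=; apply: eq_bigr => i _.
    by rewrite tnth_mktuple mulrDr.
  rewrite -d2; apply/idP/idP; lra.
rewrite !test_riskE//.
have mL := measurable_density h.
have mterm U : measurable_fun setT U -> measurable_fun setT (fun t =>
    c0%:E * ind (U t) + c1%:E * (ind (~~ U t) * (likelihood t)%:E))%E.
  move=> mU; apply: emeasurable_funD; apply: emeasurable_funM => //.
    exact: measurable_ind.
  by apply: emeasurable_funM => //; apply: measurable_ind; exact: measurable_neg.
apply: gexp_le.
- exact: mterm.
- exact: mterm.
- move=> t; rewrite adde_ge0// mule_ge0 ?ind_ge0// ?mule_ge0 ?ind_ge0// lee_fin.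
  + exact: ltW.
  + exact: ltW.
  + exact: expR_ge0.
- move=> t; rewrite /ind -!EFinM -!EFinD lee_fin.
  have SE : S t = (c0 < c1 * likelihood t).
    rewrite mulrC -ltr_pdivrMr// -[in RHS](lnK (x := c0 / c1)) ?posrE ?divr_gt0//.
    by rewrite ltr_expR ltrBrDr addrC -d2.
  have := SE; set L := likelihood t.
  by case: (S t) => /esym; case: (T t) => /=; lra.
Qed.

End testing.

(** * Optimal error for a column of given norm *)

Section bayes_error.
Context {R : realType} (n p s : nat) (a sigma : R).
Hypotheses (a_gt0 : 0 < a) (sigma_gt0 : 0 < sigma) (s_gt0 : (0 < s)%N) (sp : (s < p)%N).

Definition tnorm m (t : m.-tuple R) : R := Num.sqrt (tdot t t).

Definition thr (r : R) : R :=
  a * r / 2 + sigma ^+ 2 * ln (p%:R / s%:R - 1) / (a * r).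

(** Weighted error of the optimal test for one coordinate, given that the corresponding column has
    norm [r != 0]; the weights [p - s] and [s] are not normalised. *)
Definition bayes_err (r : R) : \bar R :=
  ((p - s)%:R%:E * gexp1 (fun x => ind (thr r < sigma * x)%R)
   + s%:R%:E * gexp1 (fun x => ind (a * r - thr r <= sigma * x)%R))%E.

Lemma norm2_col m (t : m.-tuple R) : norm2 (\col_i tnth t i) = tnorm t.
Proof.
by congr Num.sqrt; apply: eq_bigr => i _; rewrite mxE expr2.
Qed.

Lemma measurable_tnorm m : measurable_fun setT (@tnorm m).
Proof.
apply: (measurableT_comp measurable_sqrtr); apply: measurable_sum => i.
by apply: measurable_funM; exact: measurable_tnth.
Qed.

Lemma measurable_thr : measurable_fun setT thr.
Proof.
apply: measurable_funD.
  by apply: measurable_funM => //; exact: measurable_funM.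
apply: measurable_funM => //; apply: (measurableT_comp measurable_invr).
exact: measurable_funM.
Qed.

Let measurable_ind1 :
  measurable_fun setT (fun rx : R * R => ind (R := R) (thr rx.1 < sigma * rx.2)).
Proof.
apply: measurable_ind; apply: measurable_fun_ltr.
  exact: (measurableT_comp measurable_thr).
exact: measurable_funM.
Qed.

Let measurable_ind2 :
  measurable_fun setT (fun rx : R * R => ind (R := R) (a * rx.1 - thr rx.1 <= sigma * rx.2)).
Proof.
apply: measurable_ind; apply: measurable_fun_ler.
  apply: measurable_funB; first exact: measurable_funM.
  exact: (measurableT_comp measurable_thr).
exact: measurable_funM.
Qed.

Lemma measurable_bayes_err : measurable_fun setT bayes_err.
Proof.
apply: emeasurable_funD; apply: emeasurable_funM => //.
- exact: (measurable_gexp1 measurable_ind1 (fun _ => ind_ge0 _)).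
- exact: (measurable_gexp1 measurable_ind2 (fun _ => ind_ge0 _)).
Qed.

Lemma bayes_err_ge0 r : (0 <= bayes_err r)%E.
Proof.
by apply: adde_ge0; apply: mule_ge0; rewrite ?lee_fin//;
   apply: gexp1_ge0 => x; exact: ind_ge0.
Qed.

(** In [psi_plus] the scalar noise is the first coordinate, hence the outer integral. Exchanging the
    integrals conditions on [zetaof t], which enters through its norm only. *)
Lemma psi_plusE :
  psi_plus n p s a sigma = gauss_exp (fun t : n.-tuple R => bayes_err (tnorm t)).
Proof.
have swapE (Q : R -> R -> bool) :
    measurable_fun setT (fun rx : R * R => ind (R := R) (Q rx.1 rx.2)) ->
    gauss_exp (fun t : n.+1.-tuple R => (\1_[set t | Q (norm2 (zetaof t)) (epsof t)] t)%:E)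
    = gauss_exp (fun t : n.-tuple R => gexp1 (fun x => ind (Q (tnorm t) x))).
  move=> mQ; rewrite -(gexp_swap (f := fun xt => ind (Q (tnorm xt.2) xt.1))).
  - congr gexp1; apply/funext => x; apply: eq_gexp => t.
    rewrite indic_ind /epsof tnth0; congr (ind (Q _ _)).
    rewrite -norm2_col; congr norm2; apply/colP => i.
    by rewrite !mxE tnthS.
  - have mpair : measurable_fun setT (fun xt : R * n.-tuple R => (tnorm xt.2, xt.1)).
      apply: measurable_fun_pair => //.
      exact: (measurableT_comp (@measurable_tnorm n)).
    exact: (measurableT_comp mQ mpair).
  - by move=> xt; exact: ind_ge0.
have mgexp (Q : R -> R -> bool) :
    measurable_fun setT (fun rx : R * R => ind (R := R) (Q rx.1 rx.2)) ->
    measurable_fun setT (fun t : n.-tuple R => gexp1 (fun x => ind (R := R) (Q (tnorm t) x))).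
  move=> mQ; have mg := measurable_gexp1 mQ (fun _ => ind_ge0 _).
  exact: (measurableT_comp mg (@measurable_tnorm n)).
rewrite /psi_plus.
rewrite (swapE (fun r x => thr r < sigma * x))//.
rewrite (swapE (fun r x => a * r - thr r <= sigma * x))//.
have g0 (Q : R -> R -> bool) (t : n.-tuple R) :
    (0 <= gexp1 (fun x => ind (R := R) (Q (tnorm t) x)))%E.
  by apply: gexp1_ge0 => x; exact: ind_ge0.
rewrite -!gexpZl//.
- rewrite -gexpD//.
  + by apply: emeasurable_funM => //;
       exact: (mgexp (fun r x => thr r < sigma * x)).
  + by apply: emeasurable_funM => //;
       exact: (mgexp (fun r x => a * r - thr r <= sigma * x)).
  + by move=> t; apply: mule_ge0; rewrite ?lee_fin//;
       exact: (g0 (fun r x => thr r < sigma * x)).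
  + by move=> t; apply: mule_ge0; rewrite ?lee_fin//;
       exact: (g0 (fun r x => a * r - thr r <= sigma * x)).
- exact: (mgexp (fun r x => a * r - thr r <= sigma * x)).
- by move=> t; exact: (g0 (fun r x => a * r - thr r <= sigma * x)).
- exact: (mgexp (fun r x => thr r < sigma * x)).
- by move=> t; exact: (g0 (fun r x => thr r < sigma * x)).
Qed.

(** Neyman-Pearson with weights [p - s] and [s] applies to the shift [h], of norm
    [d = a / sigma * r]. Multiplying the thresholds by [d / sigma], positive since [r != 0], gives
    those of the likelihood-ratio test. *)
Lemma bayes_err_le_test (u h : n.-tuple R) (T : n.-tuple R -> bool) :
  measurable_fun setT T -> tnorm u != 0 ->
  (forall i, tnth h i = a / sigma * tnth u i) ->
  (bayes_err (tnorm u) <=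
   (p - s)%:R%:E * gauss_exp (fun t => ind (T t))
   + s%:R%:E * gauss_exp (fun t => ind (~~ T (tadd t h))))%E.
Proof.
move=> mT u0 hE.
have an : a != 0 by rewrite gt_eqF.
have sn : sigma != 0 by rewrite gt_eqF.
have thr_alg (r L : R) : r != 0 ->
    a / sigma * r / sigma * (a * r / 2 + sigma ^+ 2 * L / (a * r)) =
    (a / sigma * r) ^+ 2 / 2 + L.
  by move=> rn; field; rewrite an rn sn.
have thr_alg' (r L : R) : (a / sigma * r) ^+ 2 / 2 - L =
    a / sigma * r / sigma * (a * r) - ((a / sigma * r) ^+ 2 / 2 + L).
  by field.
have c00 : 0 < (p - s)%:R :> R by rewrite ltr0n subn_gt0.
have c10 : 0 < s%:R :> R by rewrite ltr0n.
set r := tnorm u in u0 *; set d := a / sigma * r.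
have dE : d = Num.sqrt (tdot h h).
  rewrite -[d]ger0_norm; last by rewrite mulr_ge0 ?sqrtr_ge0// ltW// divr_gt0.
  rewrite -sqrtr_sqr exprMn sqr_sqrtr ?tdot_ge0// /tdot mulr_sumr.
  by congr Num.sqrt; apply: eq_bigr => i _; rewrite hE expr2 mulrACA.
apply: le_trans (neyman_pearson c00 c10 mT dE).
have r0 : 0 < r by rewrite lt_neqAle eq_sym u0 sqrtr_ge0.
have ds0 : 0 < d / sigma by rewrite !divr_gt0// mulr_gt0// divr_gt0.
have lnE : ln (p%:R / s%:R - 1) = ln ((p - s)%:R / s%:R) :> R.
  by rewrite (natrB _ (ltnW sp)) mulrBl divff ?lt0r_neq0.
set L := ln ((p - s)%:R / s%:R).
have thrE : d / sigma * thr r = d ^+ 2 / 2 + L.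
  by rewrite /thr lnE; apply: thr_alg.
have dx x : d * x = d / sigma * (sigma * x) by rewrite mulrA divfK.
have E2 : d ^+ 2 / 2 - L = d / sigma * (a * r - thr r).
  by rewrite mulrBr thrE; apply: thr_alg'.
rewrite /bayes_err -thrE E2.
by apply: leeD; rewrite le_eqVlt; apply/orP; left; apply/eqP; congr (_ * gexp1 _)%E;
  apply/funext => x; rewrite (dx x) ?ltr_pM2l// ?ler_pM2l.
Qed.

End bayes_error.

(** * The regression model *)

Lemma index_pairs (T1 T2 : eqType) (s1 : seq T1) (s2 : seq T2) (x : T1) (y : T2) :
  x \in s1 -> y \in s2 ->
  index (x, y) [seq (u, v) | u <- s1, v <- s2] = (index x s1 * size s2 + index y s2)%N.
Proof.
move=> + ys2; elim: s1 => [//|u s1 IH] xs1 /=; rewrite index_cat size_map eq_sym.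
have [->|xu] := eqVneq u x.
  by rewrite map_f// index_map// => ? ? [].
rewrite ifN; last by apply/mapP => -[v _ [ux _]]; rewrite ux eqxx in xu.
move: xs1; rewrite inE eq_sym (negPf xu) => /= xs1.
by rewrite IH// mulSn addnA.
Qed.

(** [mxvec_index] is a rank in the enumeration of all pairs, which runs through the rows one after
    another; the closed form matches the columns of [gexp_column]. *)
Lemma val_mxvec_index n p (i : 'I_n) (j : 'I_p) :
  mxvec_index i j = (i * p + j)%N :> nat.
Proof.
have E : enum_rank (i, j) = index (i, j) (enum {: 'I_n * 'I_p}) :> nat.
  rewrite -{2}(nth_enum_rank (i, j) (i, j)) index_uniq ?enum_uniq//.
  by rewrite -cardE ltn_ord.
rewrite /mxvec_index /= E enumT unlock /= /prod_enum.
by rewrite index_pairs ?mem_enum// !index_enum_ord size_enum_ord.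
Qed.

Section model.
Context {R : realType} (n p : nat) (sigma : R).
Implicit Types (eta : 'M[R]_(n, p) -> 'cV[R]_n -> 'I_p -> bool) (b : 'cV[R]_p).
Local Notation N := (n * p + n)%N.

Definition response b (t : N.-tuple R) : 'cV[R]_n := decX t *m b + sigma *: decXi t.

(** Turns the encoding of [(X, xi)] into that of [(X, Y)]: measurability of a selector is stated on
    the second, expectations are taken over the first. *)
Definition encode b (t : N.-tuple R) : N.-tuple R :=
  [tuple match fintype.split k with
         | inl l => tnth t (lshift n l)
         | inr i => response b t i ord0
         end | k < N].

Lemma decX_encode b t : decX (encode b t) = decX t.
Proof.
apply/matrixP => i j; rewrite !mxE tnth_mktuple.
by rewrite -[lshift _ _]/(unsplit (inl _)) unsplitK.
Qed.

Lemma decXi_encode b t : decXi (encode b t) = response b t.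
Proof.
apply/colP => i; rewrite !mxE tnth_mktuple.
by rewrite -[rshift _ _]/(unsplit (inr _)) unsplitK !mxE.
Qed.

Lemma measurable_encode b : measurable_fun setT (encode b).
Proof.
apply/measurable_fun_tnthP => k.
rewrite (_ : _ \o _ = fun t => match fintype.split k with
   | inl l => tnth t (lshift n l) | inr i => response b t i ord0 end); last first.
  by apply/funext => t /=; rewrite tnth_mktuple.
case: (fintype.split k) => [l|i]; first exact: measurable_tnth.
rewrite (_ : (fun t => _) = fun t : N.-tuple R =>
  \sum_(l < p) tnth t (lshift n (mxvec_index i l)) * b l ord0
   + sigma * tnth t (rshift (n * p) i)); last first.
  apply/funext => t; rewrite !mxE; congr (_ + _).
  by apply: eq_bigr => l _; rewrite mxE.
apply: measurable_funD.
  apply: measurable_sum => l; apply: measurable_funM => //.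
  exact: measurable_tnth.
by apply: measurable_funM => //; exact: measurable_tnth.
Qed.

Lemma measurable_selector eta b j : selector eta ->
  measurable_fun setT (fun t => eta (decX t) (response b t) j).
Proof.
move=> seta.
have m0 : measurable_fun setT (fun t : N.-tuple R => eta (decX t) (decXi t) j).
  by apply: (measurable_fun_bool true); rewrite setTI; exact: seta.
have -> : (fun t => eta (decX t) (response b t) j) =
    (fun t => eta (decX t) (decXi t) j) \o encode b.
  by apply/funext => t /=; rewrite decX_encode decXi_encode.
exact: (measurableT_comp m0 (measurable_encode b)).
Qed.

End model.

(** * Truncation of selectors *)

Section truncation.
Context {R : realType} (n p s : nat).
Implicit Types (eta : 'M[R]_(n, p) -> 'cV[R]_n -> 'I_p -> bool) (v : 'I_p -> bool).

Definition trunc v : 'I_p -> bool := fun j => (\sum_k v k <= 2 * s)%N && v j.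

Lemma selector_trunc eta : selector eta ->
  selector (fun X Y => trunc (eta X Y)).
Proof.
move=> seta j.
have m0 k : measurable_fun setT
    (fun t : (n * p + n).-tuple R => eta (decX t) (decXi t) k).
  by apply: (measurable_fun_bool true); rewrite setTI; exact: seta.
have : measurable_fun setT (fun t : (n * p + n).-tuple R =>
    trunc (eta (decX t) (decXi t)) j).
  apply: measurable_and => //.
  rewrite (_ : (fun t => _) = fun t : (n * p + n).-tuple R =>
    \sum_k (eta (decX t) (decXi t) k)%:R <= (2 * s)%:R :> R); last first.
    by apply/funext => t; rewrite -natr_sum ler_nat.
  apply: measurable_fun_ler => //; apply: measurable_sum => k.
  apply/measurable_EFinP; exact: (measurable_ind (R := R) (m0 k)).
by move=> /(_ measurableT [set true] I); rewrite setTI.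
Qed.

(** If [v] selects more than [2 * s] indices, more than [s] of them lie outside [A], while the zero
    selection errs on [#|A| <= s] indices. *)
Lemma hamming_trunc_le v (A : {set 'I_p}) : (#|A| <= s)%N ->
  (hamming (trunc v) (fun j => j \in A) <= hamming v (fun j => j \in A))%N.
Proof.
move=> As; rewrite /trunc; case: (leqP (\sum_k v k) (2 * s)) => [_|vs]; first exact: leqnn.
have sumA : (\sum_j (j \in A) = #|A|)%N by rewrite -sum1_card [RHS]big_mkcond.
have -> : hamming (fun j => false && v j) (fun j => j \in A) = #|A|.
  by rewrite -sumA; apply: eq_bigr => j _; case: (j \in A).
have : (\sum_k v k <= hamming v (fun j => j \in A) + #|A|)%N.
  rewrite -sumA -big_split; apply: leq_sum => j _ /=.
  by case: (v j); case: (j \in A).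
lia.
Qed.

Lemma hamming_trunc_ub v (A : {set 'I_p}) :
  (hamming (trunc v) (fun j => j \in A) <= 2 * s + #|A|)%N.
Proof.
have sumA : (\sum_j (j \in A) = #|A|)%N by rewrite -sum1_card [RHS]big_mkcond.
apply: (@leq_trans (\sum_k trunc v k + #|A|)).
  rewrite -sumA -big_split; apply: leq_sum => j _ /=.
  by case: (trunc v j); case: (j \in A).
rewrite leq_add2r /trunc; case: (leqP (\sum_k v k) (2 * s)) => //= _.
by rewrite big1.
Qed.

End truncation.

(** * Testing a single coordinate of the signal *)

Section one_coordinate.
Context {R : realType} (n p s : nat) (a sigma : R).
Hypotheses (a_gt0 : 0 < a) (sigma_gt0 : 0 < sigma) (n_gt0 : (0 < n)%N)
  (s_gt0 : (0 < s)%N) (sp : (s < p)%N).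

(* At [r = 0] the division in [thr] returns 0 and [bayes_err] may exceed the
   error of a trivial test; this only concerns a null set of columns. *)
Definition bayes_err0 (r : R) : \bar R :=
  if r == 0 then 0%E else bayes_err p s a sigma r.

Lemma bayes_err0_ge0 r : (0 <= bayes_err0 r)%E.
Proof. by rewrite /bayes_err0; case: ifP => // _; exact: bayes_err_ge0. Qed.

Lemma measurable_bayes_err0 : measurable_fun setT bayes_err0.
Proof.
apply: measurable_fun_ifT => //; last exact: measurable_bayes_err.
apply: (measurable_fun_bool true); rewrite setTI.
by rewrite (_ : _ @^-1` _ = [set 0])//; apply/seteqP; split => x /= /eqP.
Qed.

Lemma tnorm_eq0 m (t : m.+1.-tuple R) : tnorm t = 0 -> thead t = 0.
Proof.
case/tupleP: t => x u; rewrite theadE /tnorm -/(cons_tuple x u) => /eqP.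
rewrite sqrtr_eq0 tdot_cons => xu0; apply/eqP.
rewrite -sqrf_eq0 eq_le sqr_ge0 andbT; apply: le_trans xu0.
by rewrite expr2 lerDl tdot_ge0.
Qed.

(** Since [n > 0], a vector of norm zero has a vanishing first coordinate, which is a null event. *)
Lemma psi_plus_bayes_err0 :
  psi_plus n p s a sigma = gauss_exp (fun t : n.-tuple R => bayes_err0 (tnorm t)).
Proof.
rewrite psi_plusE//; case: n n_gt0 => [//|m] _; apply: gexp_null.
- exact: (measurableT_comp (measurable_bayes_err p s a sigma) (@measurable_tnorm R _)).
- exact: (measurableT_comp measurable_bayes_err0 (@measurable_tnorm R _)).
- by move=> t; exact: bayes_err_ge0.
- by move=> t; exact: bayes_err0_ge0.
- move=> t t0; rewrite /bayes_err0 ifN//; apply: contraNneq t0 => t0.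
  by apply/eqP; exact: tnorm_eq0.
Qed.

Lemma measurable_cat m k :
  measurable_fun setT (fun uv : m.-tuple R * k.-tuple R => cat_tuple uv.1 uv.2).
Proof.
apply/measurable_fun_tnthP => i; rewrite -(splitK i).
case: (fintype.split i) => l /=.
- rewrite (_ : _ \o _ = fun uv => tnth uv.1 l); last first.
    by apply/funext => uv /=; rewrite tnth_lshift.
  exact: (measurableT_comp (@measurable_tnth _ _ _ l)).
- rewrite (_ : _ \o _ = fun uv => tnth uv.2 l); last first.
    by apply/funext => uv /=; rewrite tnth_rshift.
  exact: (measurableT_comp (@measurable_tnth _ _ _ l)).
Qed.

(** The two responses differ by [a] times column [j] of [X]. Given [X], coordinate [j] of the
    selector is thus a test between the noise and its shift by [a / sigma] times that column, and
    the column is itself a standard Gaussian vector. *)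
Lemma psi_plus_le_test (eta : 'M[R]_(n, p) -> 'cV[R]_n -> 'I_p -> bool)
    (b0 b1 : 'cV[R]_p) (j : 'I_p) :
  selector eta -> b1 = b0 + a *: delta_mx j 0 ->
  (psi_plus n p s a sigma <=
   (p - s)%:R%:E * gauss_exp (fun t => ind (eta (decX t) (response sigma b0 t) j))
   + s%:R%:E * gauss_exp (fun t => ind (~~ eta (decX t) (response sigma b1 t) j)))%E.
Proof.
move=> seta b1E; rewrite psi_plus_bayes_err0.
have mT b := measurable_selector sigma b j seta.
pose F0 t := ind (R := R) (eta (decX t) (response sigma b0 t) j).
pose F1 t := ind (R := R) (~~ eta (decX t) (response sigma b1 t) j).
have mF0 : measurable_fun setT F0 by exact: measurable_ind.
have mF1 : measurable_fun setT F1 by apply: measurable_ind; exact: measurable_neg.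
rewrite -[X in (_ <= _ * X + _)%E]/(gauss_exp F0) -[X in (_ <= _ + _ * X)%E]/(gauss_exp F1).
have combE m (f0 f1 : m.-tuple R -> \bar R) :
    measurable_fun setT f0 -> measurable_fun setT f1 ->
    (forall t, 0 <= f0 t)%E -> (forall t, 0 <= f1 t)%E ->
    ((p - s)%:R%:E * gauss_exp f0 + s%:R%:E * gauss_exp f1)%E =
    gauss_exp (fun t => (p - s)%:R%:E * f0 t + s%:R%:E * f1 t)%E.
  move=> mf0 mf1 f00 f10; rewrite -!gexpZl// -gexpD//.
  - exact: emeasurable_funM.
  - exact: emeasurable_funM.
  - by move=> t; rewrite mule_ge0// lee_fin.
  - by move=> t; rewrite mule_ge0// lee_fin.
rewrite combE//; last 2 first.
- by move=> t; exact: ind_ge0.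
- by move=> t; exact: ind_ge0.
pose F t := ((p - s)%:R%:E * F0 t + s%:R%:E * F1 t)%E.
rewrite -[X in (_ <= X)%E]/(gauss_exp F).
have mF : measurable_fun setT F.
  by apply: emeasurable_funD; exact: emeasurable_funM.
have F_ge0 t : (0 <= F t)%E.
  by rewrite adde_ge0// mule_ge0 ?ind_ge0// lee_fin.
(* Conditioning on the design: the outer expectation is over [X], the inner one over [xi]. *)
rewrite [leRHS]gexp_cat.
pose colj (x : (n * p).-tuple R) : n.-tuple R :=
  [tuple tnth x (mxvec_index i j) | i < n].
have columnE : gauss_exp (fun t : n.-tuple R => bayes_err0 (tnorm t)) =
    gauss_exp (fun x : (n * p).-tuple R => bayes_err0 (tnorm (colj x))).
  pose g (l : seq R) := bayes_err0 (Num.sqrt (\sum_(y <- l) y ^+ 2)).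
  transitivity (gauss_exp (fun t : n.-tuple R => g t)).
    apply: eq_gexp => t; congr (bayes_err0 (Num.sqrt _)).
    by rewrite big_tuple; apply: eq_bigr => i _; rewrite expr2.
  rewrite -(gexp_column n g (ltn_ord j)); apply: eq_gexp => x.
  congr (bayes_err0 (Num.sqrt _)).
  rewrite big_map -{1}(subn0 n) big_mkord; apply: eq_bigr => i _.
  by rewrite tnth_mktuple -expr2 (tnth_nth 0) val_mxvec_index.
rewrite columnE; apply: gexp_le.
- apply: (measurableT_comp measurable_bayes_err0).
  apply: (measurableT_comp (@measurable_tnorm R _)).
  apply/measurable_fun_tnthP => i.
  rewrite (_ : _ \o _ = fun x => tnth x (mxvec_index i j)); last first.
    by apply/funext => x /=; rewrite tnth_mktuple.
  exact: measurable_tnth.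
- apply: (measurable_gexp (f := fun xv => F (cat_tuple xv.1 xv.2))) => //.
  exact: (measurableT_comp mF (@measurable_cat _ _)).
- by move=> x; exact: bayes_err0_ge0.
(* At a zero column the modified Bayes error is 0, and nonnegativity of the test's risk is
   enough. *)
move=> x; rewrite /bayes_err0; case: eqVneq => [_|u0].
  by apply: gexp_ge0 => v; exact: F_ge0.
have mcat : measurable_fun setT (fun v : n.-tuple R => cat_tuple x v).
  have mpair : measurable_fun setT (fun v : n.-tuple R => (x, v)).
    exact: measurable_fun_pair.
  exact: (measurableT_comp (@measurable_cat _ _) mpair).
rewrite /F -combE; first last.
- by move=> v; exact: ind_ge0.
- by move=> v; exact: ind_ge0.
- exact: (measurableT_comp mF1 mcat).
- exact: (measurableT_comp mF0 mcat).
pose T (v : n.-tuple R) :=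
  eta (decX (cat_tuple x v)) (response sigma b0 (cat_tuple x v)) j.
pose h : n.-tuple R := [tuple a / sigma * tnth (colj x) i | i < n].
have mTx : measurable_fun setT T by exact: (measurableT_comp (mT b0) mcat).
have hE i : tnth h i = a / sigma * tnth (colj x) i by rewrite tnth_mktuple.
apply: le_trans (bayes_err_le_test a_gt0 sigma_gt0 s_gt0 sp mTx u0 hE) _.
apply: leeD => //; rewrite le_eqVlt; apply/orP; left; apply/eqP.
congr (_ * _)%E; apply: eq_gexp => v; rewrite /F1 /T.
have decXE w : decX (cat_tuple x w) = \matrix_(i, k) tnth x (mxvec_index i k).
  by apply/matrixP => i k; rewrite !mxE tnth_lshift.
rewrite !decXE; congr (ind (~~ eta _ _ _)).
(* [sigma * h] is [a] times column [j], so shifting the noise by [h] turns the response to [b0] into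
   the response to [b1]. *)
rewrite /response !decXE b1E mulmxDr -scalemxAr -colE -addrA; congr (_ + _).
apply/colP => i; rewrite !mxE !tnth_rshift tnth_mktuple hE tnth_mktuple.
by rewrite mulrDr addrC mulrA mulrCA divff ?mulr1// gt_eqF.
Qed.

End one_coordinate.

(** * Bayes risk *)

Section selection_risk.
Context {R : realType} (n p : nat) (a sigma : R).
Hypotheses (a_gt0 : 0 < a).
Implicit Types (eta : 'M[R]_(n, p) -> 'cV[R]_n -> 'I_p -> bool) (A : {set 'I_p}).

Definition set_vec A : 'cV[R]_p := \col_j (if j \in A then a else 0).

Lemma eta_of_set_vec A : eta_of (set_vec A) = (fun j => j \in A).
Proof.
apply/funext => j; rewrite /eta_of mxE; case: (j \in A); last by rewrite eqxx.
by rewrite gt_eqF.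
Qed.

Lemma set_vec_Omega s A : (#|A| <= s)%N -> Omega p s a (set_vec A).
Proof.
move=> As; split.
  rewrite (_ : #|_| = #|A|)//; apply: eq_card => j.
  by have := congr1 (fun f => f j) (eta_of_set_vec A); rewrite /eta_of => <-; exact: asboolb.
move=> j; rewrite mxE; case: (j \in A); last by rewrite eqxx.
by move=> _; exact: ler_norm.
Qed.

Lemma set_vec_setU1 A j : set_vec (j |: A) = set_vec (A :\ j) + a *: delta_mx j 0.
Proof.
apply/colP => i; rewrite !mxE eqxx andbT !inE.
by case: eqVneq => _ /=; rewrite ?mulr1 ?mulr0 ?add0r ?addr0.
Qed.

Lemma hamming_ind (u v : 'I_p -> bool) :
  ((hamming u v)%:R)%:E = (\sum_j ind (R := R) (u j != v j))%E.
Proof. by rewrite /hamming natr_sum sumEFin. Qed.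

Lemma measurable_mistake eta b j (c : bool) : selector eta ->
  measurable_fun setT (fun t => ind (R := R) (eta (decX t) (response sigma b t) j != c)).
Proof.
move=> seta; apply: measurable_ind; have mT := measurable_selector sigma b j seta.
case: c; last by under eq_fun do rewrite eqbF_neg negbK.
by under eq_fun do rewrite eqb_id; exact: measurable_neg.
Qed.

Lemma measurable_loss eta b : selector eta ->
  measurable_fun setT (fun t =>
    ((hamming (eta (decX t) (response sigma b t)) (eta_of b))%:R)%:E : \bar R).
Proof.
move=> seta; under eq_fun do rewrite hamming_ind.
by apply: emeasurable_sum => j; exact: measurable_mistake.
Qed.

Lemma risk_sum eta b : selector eta ->
  risk sigma eta b =
  (\sum_j gauss_exp (fun t => ind (eta (decX t) (response sigma b t) j != eta_of b j)))%E.
Proof.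
move=> seta; rewrite -gexp_sum; last 2 first.
- by move=> j; exact: measurable_mistake.
- by move=> j t; exact: ind_ge0.
by apply: eq_gexp => t; rewrite -hamming_ind.
Qed.

Lemma risk_ge0 eta b : (0 <= risk sigma eta b)%E.
Proof. by apply: gexp_ge0 => t; rewrite lee_fin. Qed.

Lemma risk_trunc_le s eta A : selector eta -> (#|A| <= s)%N ->
  (risk sigma (fun X Y => trunc s (eta X Y)) (set_vec A) <= risk sigma eta (set_vec A))%E.
Proof.
move=> seta As; apply: gexp_le.
- exact: (measurable_loss _ (selector_trunc s seta)).
- exact: measurable_loss.
- by move=> t; rewrite lee_fin.
- by move=> t; rewrite lee_fin ler_nat eta_of_set_vec hamming_trunc_le.
Qed.

Lemma risk_trunc_ub s eta A : selector eta ->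
  (risk sigma (fun X Y => trunc s (eta X Y)) (set_vec A) <= ((2 * s + #|A|)%:R)%:E)%E.
Proof.
move=> seta; rewrite -[leRHS](gexp_cst (n * p + n)); apply: gexp_le.
- exact: (measurable_loss _ (selector_trunc s seta)).
- exact: measurable_cst.
- by move=> t; rewrite lee_fin.
- by move=> t; rewrite lee_fin ler_nat eta_of_set_vec hamming_trunc_ub.
Qed.

Lemma gexp_ind_fin m (P : m.-tuple R -> bool) :
  measurable_fun setT P -> gauss_exp (fun t => ind (R := R) (P t)) \is a fin_num.
Proof.
move=> mP; rewrite ge0_fin_numE; last by apply: gexp_ge0 => t; exact: ind_ge0.
apply: (@le_lt_trans _ _ 1%E); last exact: ltry.
rewrite -(gexp_cst m 1%E); apply: gexp_le.
- exact: measurable_ind.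
- exact: measurable_cst.
- by move=> t; exact: ind_ge0.
- by move=> t; rewrite lee_fin; case: (P t).
Qed.

End selection_risk.

Section bayes_risk.
Context {R : realType} (n p s : nat) (a sigma s' : R).
Hypotheses (a_gt0 : 0 < a) (sigma_gt0 : 0 < sigma) (n_gt0 : (0 < n)%N)
  (s_gt0 : (0 < s)%N) (sp : (s < p)%N) (s'_gt0 : 0 < s') (s's : s' <= s%:R).
Variable eta : 'M[R]_(n, p) -> 'cV[R]_n -> 'I_p -> bool.
Hypothesis seta : selector eta.
Implicit Types A : {set 'I_p}.

Let mistake A j t : bool :=
  eta (decX t) (response sigma (set_vec a A) t) j != (j \in A).

Let perr A j : R := fine (gauss_exp (fun t => ind (mistake A j t))).

Let mistake_fin A j : gauss_exp (fun t => ind (R := R) (mistake A j t)) \is a fin_num.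
Proof.
apply: gexp_ind_fin; have mT := measurable_selector sigma (set_vec a A) j seta.
rewrite /mistake; case: (j \in A); last by under eq_fun do rewrite eqbF_neg negbK.
by under eq_fun do rewrite eqb_id; exact: measurable_neg.
Qed.

Let perr_ge0 A j : 0 <= perr A j.
Proof. by apply: fine_ge0; apply: gexp_ge0 => t; exact: ind_ge0. Qed.

Lemma risk_set_vecE A : risk sigma eta (set_vec a A) = (\sum_j perr A j)%:E.
Proof.
rewrite (risk_sum _ _ seta) -sumEFin; apply: eq_bigr => j _.
by rewrite fineK// eta_of_set_vec.
Qed.

(** A mistake at [j] is a false discovery for [A :\ j] and a miss for [j |: A]; the two signals
    differ by [a] in coordinate [j] alone. *)
Let psi_perr A j :
  (psi_plus n p s a sigma <=
   ((p - s)%:R * perr (A :\ j) j + s%:R * perr (j |: A) j)%:E)%E.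
Proof.
apply: le_trans (psi_plus_le_test a_gt0 sigma_gt0 n_gt0 s_gt0 sp seta (set_vec_setU1 a A j)) _.
rewrite EFinD !EFinM !fineK//.
apply: leeD; rewrite le_eqVlt; apply/orP; left; apply/eqP; congr (_ * _)%E;
  by apply: eq_gexp => t; rewrite /mistake !inE eqxx ?eqbF_neg ?negbK ?eqb_id.
Qed.

Lemma psi_plus_fin_num : psi_plus n p s a sigma \is a fin_num.
Proof.
rewrite ge0_fin_numE; last first.
  by rewrite psi_plusE; apply: gexp_ge0 => t; exact: bayes_err_ge0.
have p_gt0 : (0 < p)%N by rewrite (leq_trans _ sp).
by apply: le_lt_trans (psi_perr finset.set0 (Ordinal p_gt0)) _; rewrite ltry.
Qed.

Lemma bayes_risk_ge :
  s' / s%:R * fine (psi_plus n p s a sigma) <=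
  \sum_A bern_wt (s' / p%:R) A * fine (risk sigma eta (set_vec a A)).
Proof.
set psi := fine _; set q := s' / p%:R.
have p0 : 0 < p%:R :> R by rewrite ltr0n (leq_trans _ sp).
have s0 : 0 < s%:R :> R by rewrite ltr0n.
have q01 := sample_prob01 sp s'_gt0 s's.
have psi_le A j : psi <= (p - s)%:R * perr (A :\ j) j + s%:R * perr (j |: A) j.
  by rewrite -lee_fin fineK ?psi_plus_fin_num//; exact: psi_perr.
have -> : \sum_A bern_wt q A * fine (risk sigma eta (set_vec a A)) =
    \sum_j \sum_A bern_wt q A * perr A j.
  rewrite exchange_big; apply: eq_bigr => A _.
  by rewrite risk_set_vecE /= mulr_sumr.
(* Each of the [p] coordinates carries an equal share of the bound. *)
have -> : s' / s%:R * psi = \sum_(j < p) (s' / (s%:R * p%:R) * psi).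
  rewrite sumr_const card_ord -[_ *+ p]mulr_natl.
  by field; rewrite !lt0r_neq0.
apply: ler_sum => j _; rewrite (bern_wt_resample q _ j).
apply: (@le_trans _ _ (\sum_(A : {set 'I_p}) bern_wt q A * (s' / (s%:R * p%:R) * psi))).
  by rewrite -mulr_suml bern_wt_sum mul1r.
apply: ler_sum => A _; apply: ler_wpM2l; first exact: bern_wt_ge0.
have k0 : 0 <= s' / (s%:R * p%:R) by rewrite ltW// divr_gt0// mulr_gt0.
apply: le_trans (ler_wpM2l k0 (psi_le A j)) _.
rewrite mulrDr; apply: lerD; rewrite mulrA; apply: ler_wpM2r => //.
  (* False discoveries: the weight [1 - q] exceeds [s' * (p - s) / (s * p)] by exactly
     [(s - s') / s]. *)
  rewrite (natrB _ (ltnW sp)) -subr_ge0.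
  rewrite (_ : _ - _ = (s%:R - s') / s%:R); last first.
    by rewrite /q; field; rewrite !lt0r_neq0.
  by rewrite divr_ge0 ?subr_ge0// ltW.
(* Misses: the weights agree, as [s' / (s * p) * s = q]. *)
by rewrite le_eqVlt; apply/orP; left; apply/eqP; rewrite /q; field; rewrite !lt0r_neq0.
Qed.

End bayes_risk.

(** * From the averaged risk to the minimax risk *)

Theorem theorem1 (R : realType) (n p s : nat) (a sigma s' : R) :
  0 < a -> 0 < sigma -> (1 <= n)%N -> (1 <= s)%N -> (s < p)%N ->
  0 < s' -> s' <= s%:R ->
  (ereal_inf [set ereal_sup [set risk sigma eta b | b in Omega p s a]
             | eta in [set eta | @selector R n p eta]]
   >= (s' / s%:R)%:E *
      (psi_plus n p s a sigma
       - (4 * s%:R * expR (- (s%:R - s') ^+ 2 / (2 * s%:R)))%:E))%E.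
Proof.
move=> a_gt0 sigma_gt0 n_gt0 s_gt0 sp s'_gt0 s's.
apply: le_ereal_inf_tmp => _ [eta seta <-].
set E := expR _; set S := ereal_sup _.
pose eta' X Y := trunc s (eta X Y).
have seta' : selector eta' by exact: selector_trunc.
pose r (A : {set 'I_p}) := fine (risk sigma eta' (set_vec a A)).
have rE A : risk sigma eta' (set_vec a A) = (r A)%:E.
  by rewrite /r (risk_set_vecE sigma a_gt0 seta').
have r_le_S (A : {set 'I_p}) : (#|A| <= s)%N -> ((r A)%:E <= S)%E.
  move=> As; rewrite -rE; apply: le_trans (risk_trunc_le _ a_gt0 seta As) _.
  by apply: ereal_sup_ubound; exists (set_vec a A) => //; exact: set_vec_Omega.
have S_ge0 : (0 <= S)%E.
  apply: le_trans (r_le_S finset.set0 _); last by rewrite cards0.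
  by rewrite -rE; exact: risk_ge0.
have psi_fin := psi_plus_fin_num a_gt0 sigma_gt0 n_gt0 s_gt0 sp seta.
(* The supremum is nonnegative, so it is either real or [+oo], and the second case is immediate. *)
move: S_ge0 r_le_S; case: S => [S| |] // S_ge0 r_le_S; last exact: leey.
rewrite -(fineK psi_fin) -EFinB -EFinM lee_fin.
have s0 : 0 < s%:R :> R by rewrite ltr0n.
have bayes := bayes_risk_ge a_gt0 sigma_gt0 n_gt0 s_gt0 sp s'_gt0 s's seta'.
have excess := bern_wt_excess s_gt0 sp s'_gt0 s's.
have wt0 (A : {set 'I_p}) := bern_wt_ge0 (sample_prob01 sp s'_gt0 s's) A.
rewrite -/E in excess.
have upper : \sum_(A : {set 'I_p}) bern_wt (s' / p%:R) A * r A <= S + 3 * s' * E.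
  (* Small supports give signals in [Omega] and risk at most [S]; as [S >= 0], their total weight
     may be bounded by 1. On the other supports the truncated loss is at most [2 * s + #|A|]. *)
  rewrite (bigID (fun A : {set 'I_p} => (#|A| <= s)%N)) /=.
  apply: lerD.
    apply: (@le_trans _ _ (\sum_(A : {set 'I_p}) bern_wt (s' / p%:R) A * S)).
      rewrite big_mkcond; apply: ler_sum => A _; case: ifP => As.
        by rewrite ler_wpM2l// -lee_fin r_le_S.
      by rewrite mulr_ge0.
    by rewrite -mulr_suml bern_wt_sum mul1r.
  apply: le_trans excess; under eq_bigl do rewrite -ltnNge.
  apply: ler_sum => A _; rewrite ler_wpM2l// -lee_fin -rE.
  exact: risk_trunc_ub.
have E0 : 0 <= s' * E by rewrite mulr_ge0 ?expR_ge0// ltW.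
have := le_trans bayes upper; rewrite mulrBr.
(* The excess costs [3 * s' * E]; the constant 4 leaves a margin of [s' * E], nonnegative by
   [E0]. *)
have -> : s' / s%:R * (4 * s%:R * E) = 4 * (s' * E) by field; rewrite lt0r_neq0.
by rewrite -mulrA; lra.
Qed.
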